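(* Let $\lambda\in\mathbb{R}$ and let $H_0:\mathbb{R}^n\times[0,T]\times\mathbb{R}^n\to\mathbb{R}$ be continuous and satisfy: $|H_0(x,t,p)-H_0(y,t,p)|\le C_1(\beta+|p|)|x-y|$ ($C_1\ge0$, $\beta\in\{0,1\}$); $|H_0(x,t,p)-H_0(x,t,q)|\le(A_2|x|+B_2)|p-q|$ ($A_2,B_2\ge0$); $p\mapsto H_0(x,t,p)$ convex. Let $u\in C(\mathbb{R}^n\times[0,T))$ be a viscosity solution of $u_t+\lambda u+H_0(x,t,D_xu)=0$ in $\mathbb{R}^n\times(0,T)$, $u(x,0)=u_0(x)$. Then for all $(x,t)\in\mathbb{R}^n\times(0,T)$ and $p\in D_x^-u(x,t)$: (i) if $\lambda\ne-C_1$, $|p|\ge\underline{I}(x,t;u_0)e^{-(C_1+\lambda)t}-\frac{C_1\beta}{C_1+\lambda}(1-e^{-(C_1+\lambda)t})$; (ii) if $\lambda=-C_1$, $|p|\ge\underline{I}(x,t;u_0)-C_1\beta t$.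
   Context: $T>0$, $u_0:\mathbb{R}^n\to\mathbb{R}$ Lipschitz. Viscosity solution: $u\in C(\mathbb{R}^n\times[0,T))$ with $u(\cdot,0)=u_0$ such that for every $\phi\in C^1(\mathbb{R}^n\times(0,T))$, if $u-\phi$ has a local max (resp. min) at $(x,t)\in\mathbb{R}^n\times(0,T)$ then $\phi_t+\lambda u(x,t)+H_0(x,t,D_x\phi(x,t))\le0$ (resp. $\ge0$). $D^-f(x)=\{D\phi(x):\phi\in C^1,\ f-\phi$ has a local min at $x\}$; $D_x^-u(x,t)=\{p:(p,\tau)\in D^-u(x,t)\}$. $R(x,t)=(\frac{B_2}{A_2}+|x|)(e^{A_2t}-1)$ if $A_2>0$, $=B_2t$ if $A_2=0$. $\underline{I}(x,t;u_0)=\lim_{\delta\to0^+}\inf\{|p|:p\in D^-u_0(y),\ y\in\overline{B_{R(x,t)+\delta}(x)}\}$. *)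

(* Defs.v *)
From mathcomp Require Import all_boot all_order all_algebra.
From mathcomp Require Import all_classical all_reals all_analysis.

Set Implicit Arguments.
Unset Strict Implicit.
Unset Printing Implicit Defensive.

Import Order.TTheory GRing.Theory Num.Theory.
Local Open Scope ring_scope.
Local Open Scope classical_set_scope.

Section Defs.
Variables (R : realType) (n : nat).
Implicit Types (x y p q : 'rV[R]_n) (t s : R).

Definition vdot (p q : 'rV[R]_n) : R := \sum_(i < n) p ord0 i * q ord0 i.
Definition enorm (p : 'rV[R]_n) : R := Num.sqrt (vdot p p).

Definition C1_grad (f : 'rV[R]_n -> R) (g : 'rV[R]_n -> 'rV[R]_n) : Prop :=
  forall x,
    (forall e, 0 < e -> exists2 d, 0 < d &
       forall y, enorm (y - x) < d -> enorm (g y - g x) < e) /\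
    (forall e, 0 < e -> exists2 d, 0 < d &
       forall y, enorm (y - x) < d ->
         `|f y - f x - vdot (g x) (y - x)| <= e * enorm (y - x)).

Definition C1_st (T : R) (phi : 'rV[R]_n -> R -> R)
    (Dx : 'rV[R]_n -> R -> 'rV[R]_n) (Dt : 'rV[R]_n -> R -> R) : Prop :=
  forall x t, 0 < t < T ->
    (forall e, 0 < e -> exists2 d, 0 < d &
       forall y s, 0 < s < T -> enorm (y - x) < d -> `|s - t| < d ->
         enorm (Dx y s - Dx x t) < e /\ `|Dt y s - Dt x t| < e) /\
    (forall e, 0 < e -> exists2 d, 0 < d &
       forall y s, 0 < s < T -> enorm (y - x) < d -> `|s - t| < d ->
         `|phi y s - phi x t - vdot (Dx x t) (y - x) - Dt x t * (s - t)|
           <= e * (enorm (y - x) + `|s - t|)).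

Definition loc_max_st (T : R) (w : 'rV[R]_n -> R -> R) x t : Prop :=
  exists2 r, 0 < r & forall y s, 0 < s < T -> enorm (y - x) < r ->
    `|s - t| < r -> w y s <= w x t.
Definition loc_min_st (T : R) (w : 'rV[R]_n -> R -> R) x t : Prop :=
  exists2 r, 0 < r & forall y s, 0 < s < T -> enorm (y - x) < r ->
    `|s - t| < r -> w x t <= w y s.

Definition loc_min (f : 'rV[R]_n -> R) x : Prop :=
  exists2 r, 0 < r & forall y, enorm (y - x) < r -> f x <= f y.

Definition cont_st0 (T : R) (u : 'rV[R]_n -> R -> R) : Prop :=
  forall x t, 0 <= t < T -> forall e, 0 < e -> exists2 d, 0 < d &
    forall y s, 0 <= s < T -> enorm (y - x) < d -> `|s - t| < d ->
      `|u y s - u x t| < e.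

Definition cont_H (T : R) (H0 : 'rV[R]_n -> R -> 'rV[R]_n -> R) : Prop :=
  forall x t p, 0 <= t <= T -> forall e, 0 < e -> exists2 d, 0 < d &
    forall y s q, 0 <= s <= T -> enorm (y - x) < d -> `|s - t| < d ->
      enorm (q - p) < d -> `|H0 y s q - H0 x t p| < e.

Definition visc_sol (T lam : R) (H0 : 'rV[R]_n -> R -> 'rV[R]_n -> R)
    (u0 : 'rV[R]_n -> R) (u : 'rV[R]_n -> R -> R) : Prop :=
  cont_st0 T u /\ (forall x, u x 0 = u0 x) /\
  forall phi Dx Dt, C1_st T phi Dx Dt ->
  forall x t, 0 < t < T ->
    (loc_max_st T (fun y s => u y s - phi y s) x t ->
       Dt x t + lam * u x t + H0 x t (Dx x t) <= 0) /\
    (loc_min_st T (fun y s => u y s - phi y s) x t ->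
       0 <= Dt x t + lam * u x t + H0 x t (Dx x t)).

Definition subdiff (f : 'rV[R]_n -> R) x : set 'rV[R]_n :=
  [set p | exists phi g, C1_grad phi g /\ loc_min (fun y => f y - phi y) x
                         /\ p = g x].

Definition subdiff_st (T : R) (u : 'rV[R]_n -> R -> R) x t
    : set ('rV[R]_n * R) :=
  [set pt | exists phi Dx Dt, C1_st T phi Dx Dt /\
            loc_min_st T (fun y s => u y s - phi y s) x t /\
            pt = (Dx x t, Dt x t)].

Definition subdiff_x (T : R) (u : 'rV[R]_n -> R -> R) x t : set 'rV[R]_n :=
  [set p | exists tau, subdiff_st T u x t (p, tau)].

Definition Rad (A2 B2 : R) x t : R :=
  if 0 < A2 then (B2 / A2 + enorm x) * (expR (A2 * t) - 1) else B2 * t.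

(* underline I(x,t;u0), an extended real (inf of the empty set is +oo) *)
Definition Ilow (A2 B2 : R) (u0 : 'rV[R]_n -> R) x t : \bar R :=
  lim ((fun d : R =>
          ereal_inf [set (enorm p)%:E | p in
            [set p | exists y, enorm (y - x) <= Rad A2 B2 x t + d
                               /\ subdiff u0 y p]]) @ 0^'+).

End Defs.

(* Main.v *)
Require Import Defs.
From mathcomp Require Import all_boot all_order all_algebra.
From mathcomp Require Import all_classical all_reals all_analysis.
From mathcomp Require Import ring lra.
Import Order.TTheory GRing.Theory Num.Theory.
Import numFieldNormedType.Exports.
Local Open Scope ring_scope.
Local Open Scope classical_set_scope.

Set Implicit Arguments.
Unset Strict Implicit.
Unset Printing Implicit Defensive.

(** Idea.  If every subgradient of [u0] near [x] had norm larger than the asserted bound,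
    then [u0] would decrease at a rate [th] exceeding that bound.  Let
    [w z t = inf_{|e| <= 1} u (z + rho t * e) t + m t] with [rho' = C1 rho],
    [m' + lam m = - C1 beta rho] and [m 0 = th * rho 0], so that [w <= u] at time 0 on the
    domain of dependence.  The growth of the ball absorbs the [x]-dependence of the
    Hamiltonian, so [w] satisfies the subsolution inequality at its subjets; by convexity
    of the Hamiltonian this passes to superjets, and a comparison argument in a shrinking
    cone gives [w x t <= u x t].  Letting [rho] be small, this contradicts a subjet of
    spatial part [p] with [|p|] below the bound.

    The passage between subjets and superjets is the mean value argument: if a linear
    inequality [sigma + v.q <= k] holds on all subjets (or all superjets) near a segment of
    direction [(v, 1)], the slope along the segment is at most [k]. *)

(** * The Euclidean norm *)

(** The obstacle is the one-sidedness of jets. An infimum over balls transfers information only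
    through subjets, while the subsolution inequality for [u] is given only at superjets; so
    convexity is used twice, on [u] (superjets to subjets) and on the ball infimum (subjets to
    superjets). Linearizing the Hamiltonian uniformly near a point requires bounded gradients, hence
    [u] is first shown to be locally Lipschitz in space. One comparison estimate with an explicit
    modulus does both jobs: [u] against itself gives the Lipschitz bound, [w] against [u] gives
    [w <= u]. The exponential in the bound comes from the two linear equations: rho t = rho 0 exp
    (C1 t) and m t = exp (- lam t) rho 0 (th - C1 beta J t), with J the primitive of exp ((C1 + lam)
    s) vanishing at 0. At a subgradient p, w <= u forces m t <= rho t |p| up to an arbitrarily small
    error, and division by rho 0 leaves th <= exp ((C1 + lam) t) |p| + C1 beta J t. *)

Section EuclideanNorm.
Context {R : realType} {n : nat}.
Implicit Types (p q r x y : 'rV[R]_n) (a : R).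

Lemma vdotC p q : vdot p q = vdot q p.
Proof. by apply: eq_bigr => i _; rewrite mulrC. Qed.

Lemma vdotDl p q r : vdot (p + q) r = vdot p r + vdot q r.
Proof. by rewrite -big_split; apply: eq_bigr => i _; rewrite mxE mulrDl. Qed.

Lemma vdotZl a p q : vdot (a *: p) q = a * vdot p q.
Proof. by rewrite big_distrr; apply: eq_bigr => i _; rewrite mxE -mulrA. Qed.

Lemma vdotNl p q : vdot (- p) q = - vdot p q.
Proof. by rewrite -scaleN1r vdotZl mulN1r. Qed.

Lemma vdotDr p q r : vdot r (p + q) = vdot r p + vdot r q.
Proof. by rewrite vdotC vdotDl !(vdotC r). Qed.

Lemma vdotZr a p q : vdot p (a *: q) = a * vdot p q.
Proof. by rewrite vdotC vdotZl vdotC. Qed.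

Lemma vdotNr p q : vdot p (- q) = - vdot p q.
Proof. by rewrite vdotC vdotNl vdotC. Qed.

Lemma vdot0l q : vdot 0 q = 0.
Proof. by rewrite -(scale0r 0) vdotZl mul0r. Qed.

Lemma vdot0r q : vdot q 0 = 0.
Proof. by rewrite vdotC vdot0l. Qed.

Definition vdotE := (vdotDl, vdotDr, vdotNl, vdotNr, vdotZl, vdotZr).

Lemma vdot_ge0 p : 0 <= vdot p p.
Proof. by apply: sumr_ge0 => i _; rewrite -expr2 sqr_ge0. Qed.

Lemma enorm_ge0 p : 0 <= enorm p.
Proof. exact: sqrtr_ge0. Qed.

Lemma enorm_sqr p : enorm p ^+ 2 = vdot p p.
Proof. by rewrite sqr_sqrtr// vdot_ge0. Qed.

Lemma enorm_le p a : 0 <= a -> vdot p p <= a ^+ 2 -> enorm p <= a.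
Proof.
by move=> a0 h; rewrite -(ler_pXn2r (_ : 0 < 2)%N)// ?nnegrE ?enorm_ge0// enorm_sqr.
Qed.

Lemma enorm0 : enorm (0 : 'rV[R]_n) = 0.
Proof. by rewrite /enorm vdot0l sqrtr0. Qed.

Lemma enormN p : enorm (- p) = enorm p.
Proof. by rewrite /enorm vdotNl vdotNr opprK. Qed.

Lemma enormBC p q : enorm (p - q) = enorm (q - p).
Proof. by rewrite -enormN opprB. Qed.

Lemma enormZ a p : enorm (a *: p) = `|a| * enorm p.
Proof.
by rewrite /enorm vdotZl vdotZr mulrA -expr2 sqrtrM ?sqr_ge0// sqrtr_sqr.
Qed.

Lemma le_abs_enorm p i : `|p ord0 i| <= enorm p.
Proof.
rewrite -sqrtr_sqr ler_wsqrtr// /vdot (bigD1 i)//= -expr2 lerDl.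
by apply: sumr_ge0 => j _; rewrite -expr2 sqr_ge0.
Qed.

Lemma enorm_eq0 p : enorm p = 0 -> p = 0.
Proof.
move=> p0; apply/rowP => i; rewrite mxE; apply/eqP; rewrite -normr_le0 -p0.
exact: le_abs_enorm.
Qed.

Lemma vdot_le p q : vdot p q <= enorm p * enorm q.
Proof.
have [->|p0] := eqVneq p 0; first by rewrite vdot0l enorm0 mul0r.
have [->|q0] := eqVneq q 0; first by rewrite vdot0r enorm0 mulr0.
have P : 0 < enorm p.
  by rewrite lt_def enorm_ge0 andbT; apply: contra p0 => /eqP/enorm_eq0 ->.
have Q : 0 < enorm q.
  by rewrite lt_def enorm_ge0 andbT; apply: contra q0 => /eqP/enorm_eq0 ->.
have := vdot_ge0 (enorm q *: p - enorm p *: q).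
have -> : vdot (enorm q *: p - enorm p *: q) (enorm q *: p - enorm p *: q)
    = (2 * (enorm p * enorm q)) * (enorm p * enorm q - vdot p q).
  by rewrite !vdotE (vdotC q p) -!enorm_sqr; ring.
by rewrite pmulr_rge0 ?mulr_gt0// subr_ge0.
Qed.

Lemma vdot_abs p q : `|vdot p q| <= enorm p * enorm q.
Proof.
by rewrite ler_norml vdot_le andbT lerNl -vdotNl -(enormN p) vdot_le.
Qed.

Lemma enormD p q : enorm (p + q) <= enorm p + enorm q.
Proof.
apply: enorm_le; first by rewrite addr_ge0 ?enorm_ge0.
rewrite !vdotE (vdotC q p) sqrrD !enorm_sqr.
by have := vdot_le p q; lra.
Qed.

Lemma enormB p q : enorm (p - q) <= enorm p + enorm q.
Proof. by rewrite -(enormN q) enormD. Qed.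

Lemma enorm_tri r p q : enorm (p - q) <= enorm (p - r) + enorm (r - q).
Proof. by rewrite (le_trans _ (enormD _ _))// addrA subrK. Qed.

(** The topology of row vectors is that of the sup norm. The crude factor n + 1, in place of sqrt n,
    keeps the estimate polynomial and covers n = 0. *)
Lemma near_enorm x a : 0 < a -> \forall y \near x, enorm (y - x) < a.
Proof.
move=> a0.
have h (p : 'rV[R]_n) b : 0 <= b -> (forall i, `|p ord0 i| <= b) ->
    enorm p <= (n%:R + 1) * b.
  move=> b0 pb; apply: enorm_le; first by rewrite mulr_ge0.
  apply: (@le_trans _ _ (\sum_(i < n) b ^+ 2)).
    apply: ler_sum => i _; rewrite -expr2 -real_normK ?num_real//.
    by rewrite ler_pXn2r ?nnegrE.
  rewrite sumr_const card_ord -[b ^+ 2 *+ n]mulr_natl exprMn ler_wpM2r ?sqr_ge0//.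
  have : 0 <= n%:R :> R by []. 
  by nra.
have c0 : 0 < a / (n%:R + 2) by rewrite divr_gt0// ltr_wpDl.
apply/nbhs_ballP; exists (a / (n%:R + 2)) => //= y [_ xy].
apply: (@le_lt_trans _ _ ((n%:R + 1) * (a / (n%:R + 2)))).
  apply: h; first exact: ltW.
  move=> i; have := xy ord0 i; rewrite /ball/= => /ltW.
  by rewrite !mxE distrC.
rewrite mulrCA -[ltRHS]mulr1 ltr_pM2l// ltr_pdivrMr ?ltr_wpDl// mul1r.
by rewrite ltrD2l ltr1n.
Qed.

Lemma compact_eball x a : compact [set y | enorm (y - x) <= a].
Proof.
apply: bounded_closed_compact.
  exists (enorm x + `|a|); split; first by rewrite realE addr_ge0 ?enorm_ge0.
  move=> M ltM y /= ya; rewrite [leLHS]/Num.norm/= mx_normrE.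
  have yM : enorm y <= M.
    have := enormD (y - x) x; rewrite subrK; have := ler_norm a; lra.
  apply/bigmax_leP; split; first by rewrite (le_trans _ yM) ?enorm_ge0.
  by move=> [i j] _ /=; rewrite ord1 (le_trans (le_abs_enorm _ _)).
rewrite -openC => //; rewrite openE => y /= /negP; rewrite -ltNge => ay.
rewrite /interior; near=> z; apply/negP; rewrite -ltNge.
have : enorm (z - y) < enorm (y - x) - a.
  by near: z; apply: near_enorm; rewrite subr_gt0.
have := enorm_tri z y x; rewrite (enormBC z y); lra.
Unshelve. all: by end_near. Qed.

End EuclideanNorm.

Lemma near_abs {R : realType} (t a : R) : 0 < a -> \forall s \near t, `|s - t| < a.
Proof.
by move=> a0; near=> s; rewrite distrC; near: s; apply: cvgr_dist_lt => //; exact: cvg_id.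
Unshelve. all: by end_near. Qed.

(** * Compactness: uniform thresholds and maxima *)

Section Compactness.
Context {R : realType} {X : topologicalType} (A : set X) (cA : compact A).

(** Compactness in its near-covering form, for the filter of right neighbourhoods of 0: the local
    thresholds have a common one because [P] persists when [d] decreases. *)
Lemma compact_uniform (P : R -> X -> Prop) :
  (forall d d' x, 0 < d' -> d' <= d -> P d x -> P d' x) ->
  (forall x, A x -> exists2 d, 0 < d & \forall y \near x, A y -> P d y) ->
  exists2 d, 0 < d & forall x, A x -> P d x.
Proof.
move=> Pmono Ploc.
have /near_covering_withinP cov := (compact_near_coveringP A).1 cA.
have cv : \forall d \near 0^'+, A `<=` P d.
  apply: cov => x /Ploc [d d0 Pd].
  exists ([set y | A y -> P d y], [set d' | 0 < d' <= d]); first split => //=.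
    near=> d'; rewrite /=; apply/andP; split; near: d'.
      exact: nbhs_right_gt.
    exact: nbhs_right_le.
  by move=> [y d'] /= [Py] /andP[d'0 d'd] Ay; apply: Pmono (Py Ay).
have [d [d0 Pd]] : exists d, 0 < d /\ A `<=` P d.
  have := filter_ex (filterI (nbhs_right_gt (0:R)) cv).
  by move=> [d [d0 Ad]]; exists d.
by exists d.
Unshelve. all: by end_near. Qed.


(** [compact_uniform] is used twice: with the bound d^-1 it bounds f above, and if the supremum were
    not attained it would give a uniform gap below the supremum. *)
Lemma compact_max (f : X -> R) : A !=set0 ->
  (forall x, A x -> forall e, 0 < e -> \forall y \near x, A y -> f y < f x + e) ->
  exists2 x, A x & forall y, A y -> f y <= f x.
Proof.
move=> [x0 Ax0] usc.
have [d d0 fd] : exists2 d, 0 < d & forall x, A x -> f x <= d^-1.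
  apply: (compact_uniform (P := fun d x => f x <= d^-1)).
    by move=> d d' x d'0 d'd /le_trans; apply; rewrite lef_pV2// posrE (lt_le_trans d'0).
  move=> x Ax; exists (`|f x| + 1)^-1; first by rewrite invr_gt0 ltr_wpDl.
  apply: filterS (usc x Ax 1 ltr01) => y /[apply] /ltW /le_trans; apply.
  by rewrite invrK lerD2r ler_norm.
pose B := [set f x | x in A].
have B0 : B !=set0 by exists (f x0), x0.
have ubB : has_ubound B by exists d^-1 => _ [x Ax <-]; exact: fd.
have leB x : A x -> f x <= sup B by move=> Ax; apply: ub_le_sup => //; exists x.
have [[x Ax fx]|/forall2NP nomax] := pselect (exists2 x, A x & f x = sup B).
  by exists x => // y Ay; rewrite fx leB.
have [d' d'0 fd'] : exists2 d, 0 < d & forall x, A x -> f x <= sup B - d.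
  apply: (compact_uniform (P := fun d x => f x <= sup B - d)).
    by move=> e e' x e'0 e'e /le_trans; apply; rewrite lerD2l lerN2.
  move=> x Ax; have lt : 0 < sup B - f x.
    by rewrite subr_gt0 lt_neqAle leB// andbT; apply/eqP; case: (nomax x).
  exists ((sup B - f x) / 2); first by rewrite divr_gt0.
  have h := usc x Ax _ (divr_gt0 lt (ltr0n R 2)).
  by apply: filterS h => y /[apply]; lra.
have : sup B <= sup B - d' by apply: ge_sup => // _ [x Ax <-]; exact: fd'.
by lra.
Qed.

End Compactness.

(** * Jets *)

Section Jets.
Context {R : realType} {n : nat}.
Implicit Types (x y p q v : 'rV[R]_n) (s t tau sigma : R) (f : 'rV[R]_n -> R -> R).

Lemma near_st x t d : 0 < d ->
  \forall y \near (x, t), enorm (y.1 - x) < d /\ `|y.2 - t| < d.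
Proof.
move=> d0.
exists ([set y | enorm (y - x) < d], [set s | `|s - t| < d]).
  by split => /=; [exact: near_enorm | exact: near_abs].
by move=> [y s] /= [].
Qed.

Definition st_cont f x t := forall e, 0 < e -> exists2 d, 0 < d &
  forall y s, enorm (y - x) < d -> `|s - t| < d -> `|f y s - f x t| < e.

(* [fsub], [fsup] are the Frechet jets; the proximal ones, with quadratic remainder, suffice
   to test viscosity solutions and need only quadratic test functions. *)
Definition fsub f x t p tau := forall e, 0 < e -> exists2 d, 0 < d &
  forall y s, enorm (y - x) < d -> `|s - t| < d ->
    f x t + vdot p (y - x) + tau * (s - t) - e * (enorm (y - x) + `|s - t|) <= f y s.

Definition fsup f x t p tau := forall e, 0 < e -> exists2 d, 0 < d &
  forall y s, enorm (y - x) < d -> `|s - t| < d ->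
    f y s <= f x t + vdot p (y - x) + tau * (s - t) + e * (enorm (y - x) + `|s - t|).

Definition prox_sub f x t p tau := exists C, exists2 r, 0 < r &
  forall y s, enorm (y - x) < r -> `|s - t| < r ->
    f x t + vdot p (y - x) + tau * (s - t) - C * (enorm (y - x) + `|s - t|) ^+ 2
      <= f y s.

Definition prox_sup f x t p tau := exists C, exists2 r, 0 < r &
  forall y s, enorm (y - x) < r -> `|s - t| < r ->
    f y s <= f x t + vdot p (y - x) + tau * (s - t)
      + C * (enorm (y - x) + `|s - t|) ^+ 2.

Lemma prox_sub_fsub f x t p tau : prox_sub f x t p tau -> fsub f x t p tau.
Proof.
move=> [C [r r0 fC]] e e0.
have c0 : 0 < 2 * (`|C| + 1) by rewrite mulr_gt0// ltr_wpDl.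
have d0 : 0 < e / (2 * (`|C| + 1)) by rewrite divr_gt0.
exists (Num.min r (e / (2 * (`|C| + 1)))); first by rewrite lt_min r0.
move=> y s; rewrite !lt_min => /andP[yr yd] /andP[sr sd].
apply: le_trans (fC y s yr sr); rewrite lerD2l lerN2 expr2 mulrA.
apply: ler_wpM2r; first by rewrite addr_ge0 ?enorm_ge0.
have : (enorm (y - x) + `|s - t|) * (`|C| + 1) <= e.
  have -> : e = (2 * (e / (2 * (`|C| + 1)))) * (`|C| + 1).
    by field; rewrite ?mulf_neq0 ?gt_eqF// ltr_wpDl.
  by rewrite ler_wpM2r ?addr_ge0//; lra.
have := ler_norm C; have := enorm_ge0 (y - x); have := normr_ge0 (s - t).
by have := normr_ge0 C; nra.
Qed.

Lemma C1_quad T x0 t0 p tau c :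
  C1_st T (fun y s => vdot p (y - x0) + tau * (s - t0)
            + c * (vdot (y - x0) (y - x0) + (s - t0) ^+ 2))
    (fun y _ => p + (2 * c) *: (y - x0)) (fun _ s => tau + 2 * c * (s - t0)).
Proof.
move=> x t _; split=> e e0.
  have c0 : 0 < 2 * `|c| + 1 by rewrite ltr_wpDl// mulr_ge0.
  exists (e / (2 * `|c| + 1)); first by rewrite divr_gt0.
  have h a : 0 <= a -> a < e / (2 * `|c| + 1) -> 2 * `|c| * a < e.
    by rewrite ltr_pdivlMr//; nra.
  move=> y s _ yx st; split.
    have -> : p + (2 * c) *: (y - x0) - (p + (2 * c) *: (x - x0)) = (2 * c) *: (y - x).
      by rewrite opprD addrACA subrr add0r -scalerBr opprB addrA subrK.
    by rewrite enormZ normrM ger0_norm// h// enorm_ge0.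
  have -> : tau + 2 * c * (s - t0) - (tau + 2 * c * (t - t0)) = 2 * c * (s - t) by ring.
  by rewrite !normrM ger0_norm// h.
have c0 : 0 < `|c| + 1 by rewrite ltr_wpDl.
exists (e / (`|c| + 1)); first by rewrite divr_gt0.
move=> y s _; rewrite !ltr_pdivlMr// => yx st.
have ey : y - x0 = (y - x) + (x - x0) by rewrite addrA subrK.
have es : s - t0 = (s - t) + (t - t0) by rewrite addrA subrK.
rewrite {}ey {}es; move: (y - x) (x - x0) (s - t) (t - t0) yx st => a b a' b' yx st.
rewrite !vdotE (vdotC b a).
rewrite [X in `|X| <= _](_ : _ = c * (vdot a a + a' ^+ 2)); last by ring.
rewrite -enorm_sqr normrM (@ger0_norm _ (_ + _)); last by rewrite addr_ge0// sqr_ge0.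
rewrite -(real_normK (num_real a')).
have := enorm_ge0 a; have := normr_ge0 a'; have := normr_ge0 c; nra.
Qed.

Lemma visc_sub T lam H0 u0 u x t p tau : visc_sol T lam H0 u0 u -> 0 < t < T ->
  prox_sup u x t p tau -> tau + lam * u x t + H0 x t p <= 0.
Proof.
move=> [_ [_ vis]] tT [C [r r0 uC]].
(* The coefficient is twice |C| because (a + b)^2 <= 2 (a^2 + b^2): the test function has to be a
   sum of separate squares, the cross term not being C^1. *)
have [sub _] := vis _ _ _ (@C1_quad T x t p tau (2 * `|C|)) x t tT.
move: sub; rewrite !subrr scaler0 addr0 mulr0 addr0; apply.
exists r => // y s _ yx st.
rewrite !(subrr, vdot0r, mulr0, expr0n)/= !(addr0, mulr0, subr0).
have := uC y s yx st; rewrite -enorm_sqr -(real_normK (num_real (s - t))).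
have := ler_norm C; have := normr_ge0 C; set c := `|C|.
set a := enorm _; set b := `|_| => c0 Cc.
have : C * (a + b) ^+ 2 <= 2 * c * (a ^+ 2 + b ^+ 2).
  apply: (@le_trans _ _ (c * (a + b) ^+ 2)); first by rewrite ler_wpM2r// sqr_ge0.
  have -> : 2 * c * (a ^+ 2 + b ^+ 2) = c * (a + b) ^+ 2 + c * (a - b) ^+ 2 by ring.
  by rewrite lerDl mulr_ge0// sqr_ge0.
by lra.
Qed.

Lemma visc_super T lam H0 u0 u x t p tau : visc_sol T lam H0 u0 u -> 0 < t < T ->
  prox_sub u x t p tau -> 0 <= tau + lam * u x t + H0 x t p.
Proof.
move=> [_ [_ vis]] tT [C [r r0 uC]].
have [_ sup] := vis _ _ _ (@C1_quad T x t p tau (- (2 * `|C|))) x t tT.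
move: sup; rewrite !subrr scaler0 addr0 mulr0 addr0; apply.
exists r => // y s _ yx st.
rewrite !(subrr, vdot0r, mulr0, expr0n)/= !(addr0, mulr0, subr0).
have := uC y s yx st; rewrite -enorm_sqr -(real_normK (num_real (s - t))).
have := ler_norm C; have := normr_ge0 C; set c := `|C|.
set a := enorm _; set b := `|_| => c0 Cc.
have : C * (a + b) ^+ 2 <= 2 * c * (a ^+ 2 + b ^+ 2).
  apply: (@le_trans _ _ (c * (a + b) ^+ 2)); first by rewrite ler_wpM2r// sqr_ge0.
  have -> : 2 * c * (a ^+ 2 + b ^+ 2) = c * (a + b) ^+ 2 + c * (a - b) ^+ 2 by ring.
  by rewrite lerDl mulr_ge0// sqr_ge0.
by lra.
Qed.

End Jets.

Lemma cvg_vdot {R : realType} {n : nat} {I : Type} {F : set_system I} {FF : Filter F}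
    (f g : I -> 'rV[R]_n) p q : f @ F --> p -> g @ F --> q ->
  vdot (f i) (g i) @[i --> F] --> vdot p q.
Proof.
move=> fp gq; rewrite /vdot.
apply: cvg_big => [|i _]; first exact: add_continuous.
have cc (r : 'rV[R]_n) : (fun M : 'rV[R]_n => M ord0 i) @ r --> r ord0 i by exact: coord_continuous.
by apply: cvgM; [exact: (cvg_comp _ _ fp (cc p)) | exact: (cvg_comp _ _ gq (cc q))].
Qed.

Lemma compact_max_within {R : realType} {X : topologicalType} (A : set X) (f : X -> R) :
  compact A -> A !=set0 -> (forall x, A x -> f y @[y --> within A (nbhs x)] --> f x) ->
  exists2 x, A x & forall y, A y -> f y <= f x.
Proof.
move=> cA A0 fc; apply: compact_max => // x Ax e e0.
by have := cvgr_lt _ (fc x Ax) (f x + e); rewrite ltrDl; apply.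
Qed.

Section PosSquare.
Context {R : realType}.
Implicit Types z w : R.

(* The C^{1,1} function max(z, 0)^2. *)
Definition psq z := ((z + `|z|) / 2) ^+ 2.

Lemma psq_ge0 z : 0 <= psq z. Proof. exact: sqr_ge0. Qed.

Lemma psq_pos z : 0 <= z -> psq z = z ^+ 2.
Proof. by move=> z0; rewrite /psq ger0_norm//; field. Qed.

Lemma psq_neg z : z <= 0 -> psq z = 0.
Proof. by move=> z0; rewrite /psq ler0_norm// subrr mul0r expr0n. Qed.

(** z + |z| is the derivative of the squared positive part, and this derivative is 2-Lipschitz. *)
Lemma psq_taylor z w :
  `|psq w - psq z - (z + `|z|) * (w - z)| <= (w - z) ^+ 2.
Proof.
have [z0|z0] := leP 0 z; have [w0|w0] := leP 0 w.
- rewrite !psq_pos// (ger0_norm z0) [X in `|X|](_ : _ = (w - z) ^+ 2); last by ring.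
  by rewrite ger0_norm// sqr_ge0.
- rewrite (psq_neg (ltW w0)) psq_pos// (ger0_norm z0) ler_norml; apply/andP; split; nra.
- rewrite (psq_neg (ltW z0)) psq_pos// (ltr0_norm z0) ler_norml; apply/andP; split; nra.
- rewrite (psq_neg (ltW z0)) (psq_neg (ltW w0)) (ltr0_norm z0) subr0 subrr mul0r subr0 normr0.
  exact: sqr_ge0.
Qed.

Lemma continuous_psq : continuous psq.
Proof.
move=> z; apply: cvgM; apply: cvgM; (try exact: cvg_cst).
all: by apply: cvgD; [exact: cvg_id | apply: cvg_norm; exact: cvg_id].
Qed.

End PosSquare.

(** * Mean value inequalities and convex duality of jets *)

Section MeanValue.
Context {R : realType} {n : nat}.
Implicit Types (x y a p q v : 'rV[R]_n) (s t k h : R) (f : 'rV[R]_n -> R -> R).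

Lemma st_cont_cvg f x t : st_cont f x t -> f z.1 z.2 @[z --> (x, t)] --> f x t.
Proof.
move=> fc; apply/cvgrPdist_lt => e /fc [d d0 fd].
by apply: filterS (near_st x t d0) => z [? ?]; rewrite distrC; exact: fd.
Qed.

(* If a.q+sigma <= k on all superjets near a segment of direction (v, 1), the slope of f
   along the segment is at most k: otherwise f - k's, penalized off the segment and
   after its end point, has an interior maximum, whose superjet has slope >= k' > k. *)
Lemma mean_value_sup f a s0 v k r : 0 < r ->
  (forall y s, enorm (y - a) <= r -> `|s - s0| <= r -> st_cont f y s) ->
  (forall y s q sigma, enorm (y - a) < r -> `|s - s0| < r ->
     prox_sup f y s q sigma -> sigma + vdot v q <= k) ->
  forall h, 0 < h -> h * (1 + enorm v) < r -> f (a + h *: v) (s0 + h) <= f a s0 + h * k.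
Proof.
move=> r0 fc jets h h0 hr; rewrite leNgt; apply/negP => lt.
set D := f (a + h *: v) (s0 + h) - f a s0 - h * k.
have D0 : 0 < D by rewrite /D; lra.
(* Half of the excess [D] goes into the steeper slope [k']; the other half keeps the penalized
   function larger at the end point than at the start. *)
pose k' := k + D / (2 * h).
have kk' : k < k' by rewrite ltrDl divr_gt0// mulr_gt0.
have hk' : h * k' = h * k + D / 2 by rewrite /k'; field; rewrite gt_eqF.
have v0 := enorm_ge0 v.
have v1 : 0 < 1 + enorm v by rewrite ltr_pwDl.
(* The overshoot in time and the width of the tube share the room left by the segment, so the
   extended tube stays within radius [r]. *)
pose r1 := (r - h * (1 + enorm v)) / (2 * (1 + enorm v)).
have r10 : 0 < r1 by rewrite divr_gt0 ?subr_gt0// mulr_gt0.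
have r1E : (h + r1) * (1 + enorm v) + r1 * (1 + enorm v) = r.
  by rewrite /r1; field; rewrite gt_eqF.
have r1r : h + r1 + (h + r1) * enorm v + r1 <= r by rewrite -r1E; nra.
pose e := s0 + h + r1.
pose A := [set y | enorm (y - a) <= r] `*` `[s0, e]%classic.
have cA : compact A by apply: compact_setX; [exact: compact_eball | exact: segment_compact].
have AP y s : A (y, s) <-> enorm (y - a) <= r /\ s0 <= s <= e.
  by rewrite /A /= in_itv.
have inA y s : A (y, s) -> enorm (y - a) <= r /\ `|s - s0| <= r.
  move=> /AP[yr /andP[s1 s2]]; split=> //; rewrite /e in s2.
  by rewrite ger0_norm ?subr_ge0//; have : 0 <= (h + r1) * enorm v; [rewrite mulr_ge0//; lra|lra].
have Aa : A (a, s0) by apply/AP; rewrite subrr enorm0 /e; lra.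
have fcv z : A z -> f y.1 y.2 @[y --> within A (nbhs z)] --> f z.1 z.2.
  case: z => y s /inA[yr sr]; apply: cvg_within_filter; apply: st_cont_cvg.
  exact: fc.
have [[yS sS] _ fS] := compact_max_within cA (ex_intro _ _ Aa) fcv.
set S := f _ _ in fS.
have fa : st_cont f a s0 by apply: fc; rewrite subrr ?enorm0 ?normr0 ltW.
have [d d0 fd] := fa (D / 4) (divr_gt0 D0 (ltr0n R 4)).
(* A point that pays a penalty of at least [W] falls below the level f a s0 + D / 2; [N] makes this
   happen as soon as the penalized distance reaches [d] or [r1]. *)
pose W := `|S| + `|f a s0| + `|k'| * (h + r1) + 1.
have W0 : 0 < W.
  by rewrite /W ltr_wpDl// !addr_ge0// mulr_ge0//; lra.
pose N := W / d ^+ 2 + W / r1 ^+ 2.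
have N0 : 0 < N by rewrite addr_gt0// divr_gt0// exprn_gt0.
have Nd b : d <= b -> W <= N * b ^+ 2.
  move=> db; apply: (@le_trans _ _ (N * d ^+ 2)).
    rewrite mulrDl divfK ?gt_eqF ?exprn_gt0// lerDl.
    by rewrite mulr_ge0 ?divr_ge0 ?sqr_ge0 ?(ltW W0).
  by rewrite ler_wpM2l ?(ltW N0)// ler_pXn2r ?nnegrE//; lra.
have Nr b : r1 <= b -> W <= N * b ^+ 2.
  move=> db; apply: (@le_trans _ _ (N * r1 ^+ 2)).
    rewrite mulrDl (divfK (x := r1 ^+ 2)) ?gt_eqF ?exprn_gt0// lerDr.
    by rewrite mulr_ge0 ?divr_ge0 ?sqr_ge0 ?(ltW W0).
  by rewrite ler_wpM2l ?(ltW N0)// ler_pXn2r ?nnegrE//; lra.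
pose l y s := y - a - (s - s0) *: v.
(* [psq] acts only after time s0 + h, and [l] is the displacement from the moving point of the
   segment; both vanish at the end point, whose value is thus kept. *)
pose g (z : 'rV[R]_n * R) := f z.1 z.2 - k' * (z.2 - s0) - N * psq (z.2 - (s0 + h))
  - N * vdot (l z.1 z.2) (l z.1 z.2).
have gc z : A z -> g y @[y --> within A (nbhs z)] --> g z.
  move=> Az.
  have c1 : y.1 @[y --> within A (nbhs z)] --> z.1.
    by apply: cvg_within_filter; exact: cvg_fst.
  have c2 : y.2 @[y --> within A (nbhs z)] --> z.2.
    by apply: cvg_within_filter; exact: cvg_snd.
  have cl : l y.1 y.2 @[y --> within A (nbhs z)] --> l z.1 z.2.
    apply: cvgB; first by apply: cvgB => //; exact: cvg_cst.
    by apply: cvgZ; [apply: cvgB => //; exact: cvg_cst|exact: cvg_cst].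
  apply: cvgB; last by apply: cvgM; [exact: cvg_cst | exact: cvg_vdot].
  apply: cvgB; last first.
    apply: cvgM; first exact: cvg_cst.
    apply: (cvg_comp (fun y : 'rV[R]_n * R => y.2 - (s0 + h)) psq); last exact: continuous_psq.
    by apply: cvgB => //; exact: cvg_cst.
  apply: cvgB; first exact: fcv.
  by apply: cvgM; [exact: cvg_cst | apply: cvgB => //; exact: cvg_cst].
have [[ym sm] Am gm] := compact_max_within cA (ex_intro _ _ Aa) gc.
have Ab : A (a + h *: v, s0 + h).
  apply/AP; rewrite (addrC a) addrK enormZ gtr0_norm// /e.
  by split; [nra | lra].
have := gm _ Ab; rewrite {1}/g /=.
have -> : l (a + h *: v) (s0 + h) = 0.
  by rewrite /l (addrC a) addrK (addrC s0) addrK subrr.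
have e1 : s0 + h - s0 = h by ring.
rewrite vdot0r subrr psq_neg// !mulr0 !subr0 e1 (mulrC k') => gb.
have {gb} gb : f a s0 + D / 2 <= g (ym, sm) by apply: le_trans gb; rewrite hk' /D; lra.
have [ymr /andP[sm0 sme]] := (AP _ _).1 Am.
have fm : f ym sm <= S by exact: (fS (ym, sm)).
have kb : - k' * (sm - s0) <= `|k'| * (h + r1).
  apply: (@le_trans _ _ (`|k'| * (sm - s0))).
    by rewrite ler_wpM2r ?subr_ge0// -normrN ler_norm.
  by rewrite ler_wpM2l// lerBlDl addrA.
have bound P : W <= P -> f ym sm - k' * (sm - s0) - P < f a s0 + D / 2.
  have := ler_norm S; have := ler_norm (- f a s0); rewrite normrN /W; lra.
have p0 := psq_ge0 (sm - (s0 + h)); have l0 := vdot_ge0 (l ym sm).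
have Np0 := mulr_ge0 (ltW N0) p0; have Nl0 := mulr_ge0 (ltW N0) l0.
have lr : enorm (l ym sm) < r1.
  rewrite ltNge; apply/negP => /Nr; rewrite enorm_sqr => /bound.
  by move: gb; rewrite /g/=; lra.
have smlt : sm < e.
  rewrite lt_neqAle sme andbT; apply/eqP => se.
  have /bound : W <= N * psq (sm - (s0 + h)).
    rewrite psq_pos; last by rewrite se /e; lra.
    by apply: Nr; rewrite se /e; lra.
  by move: gb; rewrite /g/=; lra.
have ymlt : enorm (ym - a) < r.
  have -> : ym - a = l ym sm + (sm - s0) *: v by rewrite /l subrK.
  apply: le_lt_trans (enormD _ _) _; rewrite enormZ ger0_norm ?subr_ge0//.
  have : (sm - s0) * enorm v <= (h + r1) * enorm v.
    by rewrite ler_wpM2r//; rewrite /e in sme; lra.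
  by lra.
(* At the starting time, points at distance at least [d] from [a] are excluded by the penalty, and
   closer ones by continuity, since they gain less than D / 4. *)
have smgt : s0 < sm.
  rewrite lt_neqAle sm0 andbT; apply/eqP => se.
  move: gb; rewrite /g /= -se subrr mulr0 subr0.
  have -> : l ym s0 = ym - a by rewrite /l subrr scale0r subr0.
  have := Np0; rewrite -se -enorm_sqr => Np.
  have [/Nd/bound|yd] := leP d (enorm (ym - a)).
    by rewrite -se subrr mulr0; lra.
  have := fd ym s0 yd; rewrite subrr normr0 => /(_ d0).
  by have := mulr_ge0 (ltW N0) (sqr_ge0 (enorm (ym - a))); rewrite ltr_norml; lra.
set z := sm - (s0 + h).
have jet : prox_sup f ym sm ((2 * N) *: l ym sm)
    (k' + N * (z + `|z|) - 2 * N * vdot (l ym sm) v).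
  exists (N + N * (1 + enorm v) ^+ 2), (Num.min (r - enorm (ym - a)) (Num.min (sm - s0) (e - sm))).
    by rewrite !lt_min !subr_gt0 ymlt smgt.
  move=> y s; rewrite !lt_min => /andP[yr _] /andP[_ /andP[s1 s2]].
  have Ay : A (y, s).
    apply/AP; split; first by have := enorm_tri ym y a; lra.
    by move: s1 s2; rewrite !ltr_norml => /andP[? ?] /andP[? ?]; apply/andP; lra.
  have := gm _ Ay; rewrite /g /=.
  have -> : l y s = l ym sm + ((y - ym) - (s - sm) *: v).
    rewrite /l addrACA -opprD -scalerDl; congr (_ - _ *: _); last by ring.
    by rewrite addrC addrA subrK.
  have := psq_taylor z (s - (s0 + h)); rewrite -/z.
  rewrite (_ : s - (s0 + h) - z = s - sm); last by rewrite /z; ring.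
  move=> /ler_normlP[_ pt].
  have Dl : enorm ((y - ym) - (s - sm) *: v) <= (1 + enorm v) * (enorm (y - ym) + `|s - sm|).
    apply: le_trans (enormB _ _) _; rewrite enormZ.
    by have := enorm_ge0 (y - ym); have := normr_ge0 (s - sm); nra.
  have {Dl} : vdot ((y - ym) - (s - sm) *: v) ((y - ym) - (s - sm) *: v)
      <= (1 + enorm v) ^+ 2 * (enorm (y - ym) + `|s - sm|) ^+ 2.
    rewrite -enorm_sqr -exprMn ler_pXn2r// ?nnegrE ?enorm_ge0//.
    by apply: le_trans Dl; exact: enorm_ge0.
  have sq : (s - sm) ^+ 2 <= (enorm (y - ym) + `|s - sm|) ^+ 2.
    rewrite -(real_normK (num_real (s - sm))) ler_pXn2r ?nnegrE ?addr_ge0 ?enorm_ge0//.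
    by rewrite lerDr enorm_ge0.
  move: (l ym sm) (enorm (y - ym) + _) sq => L b sq.
  set Dv := y - ym - (s - sm) *: v.
  rewrite !(vdotDl L) !(vdotDr L) (vdotC Dv L).
  have -> : vdot ((2 * N) *: L) (y - ym) = 2 * N * (vdot L Dv + (s - sm) * vdot L v).
    by rewrite /Dv !vdotE; ring.
  move: (vdot L Dv) (vdot L v) (vdot L L) (vdot Dv Dv) => LD Lv LL DD.
  move=> DDle gle.
  have h1 : N * DD <= N * ((1 + enorm v) ^+ 2 * b ^+ 2) by rewrite ler_pM2l.
  have h2 : N * (s - sm) ^+ 2 <= N * b ^+ 2 by rewrite ler_pM2l.
  have h3 : N * (psq (s - (s0 + h)) - psq z - (z + `|z|) * (s - sm)) <= N * (s - sm) ^+ 2 by rewrite ler_pM2l.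
  lra.
have smr : `|sm - s0| < r.
  by rewrite ger0_norm ?subr_ge0//; have := mulr_ge0 (ltW (addr_gt0 h0 r10)) v0; rewrite /e in smlt; lra.
(* In sigma + v.q the contributions of the penalty on [l] cancel and that of [psq] is nonnegative,
   so at least [k'] remains. *)
have := jets _ _ _ _ ymlt smr jet; rewrite vdotZr (vdotC v) addrNK.
have : 0 <= N * (z + `|z|).
  by rewrite mulr_ge0 ?(ltW N0)//; have := ler_norm (- z); rewrite normrN; lra.
by lra.
Qed.

End MeanValue.

Section MeanValueSub.
Context {R : realType} {n : nat}.
Implicit Types (x y a p q v : 'rV[R]_n) (s t k h tau : R) (f : 'rV[R]_n -> R -> R).

(* The reflection f~(y, s) = - f(-y, -s) exchanges sub- and superjets. *)
Lemma mean_value_sub f a s0 v k r : 0 < r ->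
  (forall y s, enorm (y - a) <= r -> `|s - s0| <= r -> st_cont f y s) ->
  (forall y s q sigma, enorm (y - a) < r -> `|s - s0| < r ->
     prox_sub f y s q sigma -> sigma + vdot v q <= k) ->
  forall h, 0 < h -> h * (1 + enorm v) < r -> f a s0 <= f (a - h *: v) (s0 - h) + h * k.
Proof.
move=> r0 fc jets h h0 hr.
have eN y b : enorm (- y - b) = enorm (y - - b) by rewrite -enormN opprD !opprK.
have aN (s b : R) : `|- s - b| = `|s - - b| by rewrite -normrN opprD !opprK.
pose f' y s := - f (- y) (- s).
have fc' y s : enorm (y - - a) <= r -> `|s - - s0| <= r -> st_cont f' y s.
  rewrite -eN -aN => ya ss e e0; have [d d0 fd] := fc _ _ ya ss e e0.
  exists d => // z b zy bs; rewrite /f' -opprD normrN.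
  by apply: fd; rewrite ?eN ?aN opprK.
have jets' y s q sigma : enorm (y - - a) < r -> `|s - - s0| < r ->
    prox_sup f' y s q sigma -> sigma + vdot v q <= k.
  rewrite -eN -aN => ya ss [C [d d0 fd]].
  apply: (jets (- y) (- s)) => //; exists C; exists d => // z b.
  move=> zy bs; have := fd (- z) (- b); rewrite /f' !opprK eN aN => /(_ zy bs).
  have -> : - z - y = - (z - - y) by rewrite opprB addrC.
  by rewrite vdotNr !opprK; lra.
have := mean_value_sup r0 fc' jets' h0 hr.
by rewrite /f' !opprD !opprK; lra.
Qed.

(** A subjet bounds f from below, so an upper bound on increments along (v, 1) is tested forward in
    time; for superjets the same bound is tested backward. *)
Lemma fsub_speed f x t p tau v k r : 0 < r -> fsub f x t p tau ->
  (forall h, 0 < h -> h < r -> f (x + h *: v) (t + h) <= f x t + h * k) ->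
  tau + vdot v p <= k.
Proof.
move=> r0 fs slope; apply/ler_addgt0Pr => e e0.
have v1 : 0 < enorm v + 1 by rewrite ltr_wpDl ?enorm_ge0.
have [d d0 fd] := fs (e / (enorm v + 1)) (divr_gt0 e0 v1).
pose h := Num.min (r / 2) (d / (2 * (enorm v + 1))).
have h0 : 0 < h by rewrite lt_min !divr_gt0// mulr_gt0.
have hr : h < r by rewrite gt_min; apply/orP; left; lra.
have hd : h * (enorm v + 1) < d.
  have : h <= d / (2 * (enorm v + 1)) by rewrite ge_min lexx orbT.
  by rewrite ler_pdivlMr ?mulr_gt0//; nra.
have := slope h h0 hr; have := fd (x + h *: v) (t + h).
rewrite (addrC x) addrK (addrC t) addrK enormZ gtr0_norm// => H.
have hv : h * enorm v < d by have := mulr_ge0 (ltW h0) (enorm_ge0 v); lra.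
have {H} := H hv _; have -> : h * enorm v + h = h * (enorm v + 1) by ring.
rewrite (mulrCA _ h) divfK ?gt_eqF// vdotZr (vdotC p).
have hd' : h < d by have := mulr_ge0 (ltW h0) (enorm_ge0 v); lra.
by move=> /(_ hd') h1 h2; rewrite -(ler_pM2l h0); lra.
Qed.

Lemma fsup_speed f x t p tau v k r : 0 < r -> fsup f x t p tau ->
  (forall h, 0 < h -> h < r -> f x t <= f (x - h *: v) (t - h) + h * k) ->
  tau + vdot v p <= k.
Proof.
move=> r0 fs slope; apply/ler_addgt0Pr => e e0.
have v1 : 0 < enorm v + 1 by rewrite ltr_wpDl ?enorm_ge0.
have [d d0 fd] := fs (e / (enorm v + 1)) (divr_gt0 e0 v1).
pose h := Num.min (r / 2) (d / (2 * (enorm v + 1))).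
have h0 : 0 < h by rewrite lt_min !divr_gt0// mulr_gt0.
have hr : h < r by rewrite gt_min; apply/orP; left; lra.
have hd : h * (enorm v + 1) < d.
  have : h <= d / (2 * (enorm v + 1)) by rewrite ge_min lexx orbT.
  by rewrite ler_pdivlMr ?mulr_gt0//; nra.
have := slope h h0 hr; have := fd (x - h *: v) (t - h).
rewrite (addrC x) addrK (addrC t) addrK enormN normrN enormZ gtr0_norm// => H.
have hv : h * enorm v < d by have := mulr_ge0 (ltW h0) (enorm_ge0 v); lra.
have {H} := H hv _; have -> : h * enorm v + h = h * (enorm v + 1) by ring.
rewrite (mulrCA _ h) divfK ?gt_eqF// vdotNr vdotZr (vdotC p).
have hd' : h < d by have := mulr_ge0 (ltW h0) (enorm_ge0 v); lra.
by move=> /(_ hd') h1 h2; rewrite -(ler_pM2l h0); lra.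
Qed.

(** Increments along a segment do not remember which jets bounded them: the inequality is integrated
    from superjets and differentiated again at a subjet. *)
Lemma sup_jets_sub f a s0 v k r p tau : 0 < r ->
  (forall y s, enorm (y - a) <= r -> `|s - s0| <= r -> st_cont f y s) ->
  (forall y s q sigma, enorm (y - a) < r -> `|s - s0| < r ->
     prox_sup f y s q sigma -> sigma + vdot v q <= k) ->
  fsub f a s0 p tau -> tau + vdot v p <= k.
Proof.
move=> r0 fc jets fs.
have v1 : 0 < 1 + enorm v by rewrite ltr_wpDr ?enorm_ge0.
apply: (fsub_speed (divr_gt0 r0 v1) fs) => h h0; rewrite ltr_pdivlMr// => hr.
exact: (mean_value_sup r0 fc jets).
Qed.

Lemma sub_jets_sup f a s0 v k r p tau : 0 < r ->
  (forall y s, enorm (y - a) <= r -> `|s - s0| <= r -> st_cont f y s) ->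
  (forall y s q sigma, enorm (y - a) < r -> `|s - s0| < r ->
     prox_sub f y s q sigma -> sigma + vdot v q <= k) ->
  fsup f a s0 p tau -> tau + vdot v p <= k.
Proof.
move=> r0 fc jets fs.
have v1 : 0 < 1 + enorm v by rewrite ltr_wpDr ?enorm_ge0.
apply: (fsup_speed (divr_gt0 r0 v1) fs) => h h0; rewrite ltr_pdivlMr// => hr.
exact: (mean_value_sub r0 fc jets).
Qed.

End MeanValueSub.

(** * Convexity of the Hamiltonian and the exchange of subjets and superjets *)

Section ApproxSubgradient.
Context {R : realType} {n : nat} (G : 'rV[R]_n -> R) (l : R).
Hypotheses (l0 : 0 <= l) (lipG : forall p q, `|G p - G q| <= l * enorm (p - q)).
Hypothesis convG : forall p q (th : R), 0 <= th <= 1 ->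
  G (th *: p + (1 - th) *: q) <= th * G p + (1 - th) * G q.

(* The subgradient is read off at a minimizer of G + (c/2)|. - p|^2 with c large. *)
Lemma approx_subgradient p eta : 0 < eta ->
  exists v, forall q, G p + vdot v (q - p) - eta <= G q.
Proof.
move=> eta0.
(* The minimizer turns out to lie within 2 l / c of [p], and this [c] gives l (2 l / c) <= eta. *)
pose c := 2 * (l ^+ 2 + 1) / eta.
have c0 : 0 < c by rewrite divr_gt0// mulr_gt0// ltr_wpDl// sqr_ge0.
have ceta : c * eta = 2 * (l ^+ 2 + 1) by rewrite /c divfK// gt_eqF.
clearbody c.
(* Outside this ball the quadratic term beats the Lipschitz growth of [G], so the maximizer of [g]
   on the ball is global. *)
pose A : set 'rV[R]_n := [set q | enorm (q - p) <= 2 * l / c + 1].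
pose g q := - G q - c / 2 * vdot (q - p) (q - p).
have gc q : A q -> g y @[y --> within A (nbhs q)] --> g q.
  move=> _; have cq : y - p @[y --> within A (nbhs q)] --> q - p.
    by apply: cvgB; [exact: cvg_within | exact: cvg_cst].
  apply: cvgB; last by apply: cvgM; [exact: cvg_cst | exact: (cvg_vdot cq cq)].
  apply: cvgN; apply: cvg_within_filter; apply/cvgrPdist_lt => e e0.
  have l1 : 0 < l + 1 by rewrite ltr_wpDl.
  apply: filterS (near_enorm q (divr_gt0 e0 l1)) => y; rewrite ltr_pdivlMr// => yq.
  apply: le_lt_trans (lipG _ _) _; rewrite enormBC; have := enorm_ge0 (y - q); lra.
have Ap : A p by rewrite /A/= subrr enorm0 addr_ge0// divr_ge0 ?(ltW c0) ?mulr_ge0.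
have [q0 Aq0 gmax] := compact_max_within (@compact_eball _ _ p _) (ex_intro _ p Ap) gc.
have gp : g q0 >= - G p by have := gmax p Ap; rewrite {1}/g subrr vdot0r mulr0 subr0.
have glob q : g q <= g q0.
  have [/gmax//|/negP] := pselect (A q); rewrite /A /= -ltNge => qp.
  apply: le_trans gp; rewrite /g -enorm_sqr.
  have /ler_normlP[_ hG] := lipG p q; rewrite enormBC in hG.
  have : 2 * l <= c * enorm (q - p).
    rewrite -ler_pdivrMl// mulrC; lra.
  by have := enorm_ge0 (q - p); nra.
exists (c *: (p - q0)) => r.
have sub : G q0 + c * vdot (p - q0) (r - q0) <= G r.
  rewrite -subr_le0; set B := vdot (r - q0) (r - q0).
  have B0 : 0 <= B by exact: vdot_ge0.
  (* Compare [q0] with the point a fraction [th] of the way to [r]: after division by [th] the only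
     error is the second-order part of the square, which vanishes with [th]. So c (p - q0) is an
     exact subgradient at [q0]. *)
  have key th : 0 < th -> th <= 1 ->
      G q0 + c * vdot (p - q0) (r - q0) - G r <= th * (c / 2 * B).
    move=> th0 th1; have := glob (th *: r + (1 - th) *: q0).
    have /(convG r q0) : 0 <= th <= 1 by rewrite (ltW th0).
    have -> : th *: r + (1 - th) *: q0 = q0 + th *: (r - q0).
      by rewrite scalerBl scale1r scalerBr addrCA addrA.
    rewrite /g (_ : q0 + th *: (r - q0) - p = - (p - q0) + th *: (r - q0)); last first.
      by rewrite opprB addrAC.
    rewrite -(opprB p q0) /B; move: (p - q0) (r - q0) => d w.
    rewrite !vdotE (vdotC w d).
    by move=> cv mx; rewrite -(ler_pM2l th0); lra.
  apply/ler_addgt0Pr => e e0; rewrite add0r.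
  have b0 : 0 < c / 2 * B + e by rewrite ltr_wpDl// mulr_ge0// divr_ge0// ltW.
  have := key (e / (c / 2 * B + e)) (divr_gt0 e0 b0).
  rewrite ler_pdivrMr// mul1r lerDr mulr_ge0 ?divr_ge0 ?(ltW c0)// => /(_ isT).
  move/le_trans; apply; rewrite mulrAC ler_pdivrMr// ler_wpM2l ?(ltW e0)//.
  by rewrite lerDl ltW.
have d0 : c * enorm (q0 - p) <= 2 * l.
  rewrite leNgt; apply/negP => lt.
  have := gp; rewrite /g -enorm_sqr => gq.
  have /ler_normlP[_ hG] := lipG p q0; rewrite enormBC in hG.
  have := enorm_ge0 (q0 - p).
  rewrite le_eqVlt => /orP[/eqP e|e]; last by nra.
  by move: lt; rewrite -e mulr0 ltNge mulr_ge0.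
have /ler_normlP[_ hG] := lipG p q0.
have ld : l * enorm (p - q0) <= eta.
  rewrite -(ler_pM2l c0) mulrCA enormBC ceta; have := ler_wpM2l l0 d0; rewrite expr2.
  by nra.
move: sub; rewrite (_ : r - q0 = (r - p) + (p - q0)); last by rewrite addrA subrK.
by rewrite vdotDr vdotZl; have := mulr_ge0 (ltW c0) (vdot_ge0 (p - q0)); lra.
Qed.

End ApproxSubgradient.

Section JetBounds.
Context {R : realType} {n : nat}.
Implicit Types (x y p q : 'rV[R]_n) (s t tau L : R) (f : 'rV[R]_n -> R -> R).

Lemma fsub_enorm_le f x t p tau L r : 0 < r -> 0 <= L ->
  (forall y, enorm (y - x) < r -> f y t - f x t <= L * enorm (y - x)) ->
  fsub f x t p tau -> enorm p <= L.
Proof.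
move=> r0 L0 lip fs; apply/ler_addgt0Pr => e e0.
have [->|p0] := eqVneq p 0; first by rewrite enorm0 addr_ge0// ltW.
have P : 0 < enorm p.
  by rewrite lt_def enorm_ge0 andbT; apply: contra p0 => /eqP/enorm_eq0 ->.
have [d d0 fd] := fs e e0.
have m0 : 0 < Num.min r d by rewrite lt_min r0.
pose h := Num.min r d / (2 * enorm p).
have h0 : 0 < h by rewrite divr_gt0// mulr_gt0.
have hm : h * enorm p < Num.min r d.
  rewrite (_ : h * enorm p = Num.min r d / 2); last by rewrite /h; field; rewrite gt_eqF.
  lra.
have := fd (x + h *: p) t; have := lip (x + h *: p).
rewrite (addrC x) addrK enormZ gtr0_norm// subrr normr0 mulr0 !addr0.
move: hm; rewrite lt_min => /andP[hr hd] /(_ hr) l1 /(_ hd d0).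
rewrite vdotZr -enorm_sqr => l2.
have hp : 0 < h * enorm p by rewrite mulr_gt0.
by rewrite -(ler_pM2l hp); lra.
Qed.

Lemma prox_sup_subN f x t p tau :
  prox_sup f x t p tau -> prox_sub (fun y s => - f y s) x t (- p) (- tau).
Proof.
move=> [C [d d0 fd]]; exists C; exists d => // y s yx st.
by have := fd y s yx st; rewrite vdotNl mulNr; lra.
Qed.

Lemma prox_sup_enorm_le f x t p tau L r : 0 < r -> 0 <= L ->
  (forall y, enorm (y - x) < r -> f x t - f y t <= L * enorm (y - x)) ->
  prox_sup f x t p tau -> enorm p <= L.
Proof.
move=> r0 L0 lip /prox_sup_subN/prox_sub_fsub; rewrite -(enormN p).
by apply: (fsub_enorm_le r0 L0) => y /lip; lra.
Qed.

End JetBounds.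

Section BarronJensen.
Context {R : realType} {n : nat} (T lam A2 B2 : R) (H0 : 'rV[R]_n -> R -> 'rV[R]_n -> R).
Hypotheses (A20 : 0 <= A2) (B20 : 0 <= B2) (contH : cont_H T H0).
Hypothesis lipp : forall x t p q, 0 <= t <= T ->
  `|H0 x t p - H0 x t q| <= (A2 * enorm x + B2) * enorm (p - q).
Hypothesis convH : forall x t p q (th : R), 0 <= t <= T -> 0 <= th <= 1 ->
  H0 x t (th *: p + (1 - th) *: q) <= th * H0 x t p + (1 - th) * H0 x t q.
Implicit Types (x y p q v : 'rV[R]_n) (s t tau sigma L : R) (f : 'rV[R]_n -> R -> R).

(** The affine function is almost tight at (x, t, p). The modulus of continuity of the Hamiltonian
    is uniform over a compact set of momenta, whence the bound [L]. *)
Lemma affine_minorant x t p L eta : 0 <= t <= T -> 0 < eta ->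
  exists v, exists2 r, 0 < r & forall y s q, enorm (y - x) < r -> `|s - t| < r ->
    0 <= s <= T -> enorm q <= L -> H0 x t p + vdot v (q - p) - eta <= H0 y s q.
Proof.
move=> tT eta0.
have l0 : 0 <= A2 * enorm x + B2 by rewrite addr_ge0// mulr_ge0// enorm_ge0.
have [v vP] := approx_subgradient l0 (fun p q => @lipp x t p q tT)
  (fun p q th => @convH x t p q th tT) p (divr_gt0 eta0 (ltr0n R 2)).
pose P (d : R) q := forall y s, enorm (y - x) < d -> `|s - t| < d -> 0 <= s <= T ->
  `|H0 y s q - H0 x t q| < eta / 2.
have [r r0 rP] : exists2 r, 0 < r & forall q, [set q | enorm (q - 0) <= L] q -> P r q.
  apply: compact_uniform; first exact: compact_eball.
    by move=> d d' q d'0 d'd Pd y s yx st; apply: Pd; exact: lt_le_trans d'd.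
  move=> q _; have [d d0 dP] := @contH x t q tT (eta / 4) (divr_gt0 eta0 (ltr0n R 4)).
  exists d => //; apply: filterS (near_enorm q d0) => q' q'q _ y s yx st sT.
  have := dP y s q' sT yx st q'q; have := dP x t q' tT.
  by rewrite !subrr enorm0 normr0 => /(_ d0 d0 q'q); rewrite !ltr_norml; lra.
exists v, r => // y s q yx st sT qL.
have := rP q _ y s yx st sT; rewrite /= subr0 => /(_ qL).
by have := vP q; rewrite ltr_norml; lra.
Qed.

(** Puts the Hamiltonian inequality into the linear form that the mean value argument accepts; [e]
    is split between the affine minorant and the variation of lam f. *)
Lemma local_speed f x t L p e : 0 < t < T -> st_cont f x t -> 0 < e ->
  exists v, exists2 r, 0 < r & forall y s q sigma,
    enorm (y - x) < r -> `|s - t| < r -> enorm q <= L ->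
    sigma + lam * f y s + H0 y s q <= 0 ->
    sigma + vdot v q <= vdot v p - lam * f x t - H0 x t p + e.
Proof.
move=> tT fc e0; have tT' : 0 <= t <= T by lra.
have e20 : 0 < e / 2 by lra.
have [v [r r0 rP]] := affine_minorant x p L tT' e20.
have l0 : 0 < `|lam| + 1 by rewrite ltr_wpDl.
have [d d0 dP] := fc _ (divr_gt0 e20 l0).
exists v, (Num.min (Num.min r d) (Num.min t (T - t))).
  by rewrite !lt_min r0 d0/=; lra.
move=> y s q sigma; rewrite !lt_min => /andP[/andP[yr yd] _].
move=> /andP[/andP[sr sd] /andP[st sT]] qL.
have sT' : 0 <= s <= T by move: st sT; rewrite !ltr_norml; lra.
have := rP y s q yr sr sT' qL; rewrite vdotDr vdotNr.
have := dP y s yd sd; rewrite ltr_pdivlMr// => fd.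
have : `|lam * (f y s - f x t)| <= e / 2.
  by rewrite normrM; have := normr_ge0 (f y s - f x t); lra.
by move=> /ler_normlP[]; lra.
Qed.

(** The linear inequality is built for the very [p] of the given jet, where the affine minorant is
    tight; the terms v.p then cancel and the inequality at [p] comes back up to [e]. *)
Lemma barron_jensen_sub f x t L r p tau : 0 < t < T -> 0 < r ->
  (forall y s, enorm (y - x) <= r -> `|s - t| <= r -> st_cont f y s) ->
  (forall y s q sigma, enorm (y - x) < r -> `|s - t| < r -> prox_sup f y s q sigma ->
     enorm q <= L /\ sigma + lam * f y s + H0 y s q <= 0) ->
  fsub f x t p tau -> tau + lam * f x t + H0 x t p <= 0.
Proof.
move=> tT r0 fc jets fs; apply/ler_addgt0Pr => e e0.
have fx : st_cont f x t by apply: fc; rewrite subrr ?enorm0 ?normr0 ltW.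
have [v [r1 r10 rP]] := local_speed L p tT fx e0.
have m0 : 0 < Num.min r r1 by rewrite lt_min r0.
suff : tau + vdot v p <= vdot v p - lam * f x t - H0 x t p + e by lra.
apply: (sup_jets_sub m0 _ _ fs) => [y s|y s q sigma].
  by rewrite !le_min => /andP[yr _] /andP[sr _]; exact: fc.
rewrite !lt_min => /andP[yr yr1] /andP[sr sr1] /(jets _ _ _ _ yr sr)[qL].
exact: rP.
Qed.

Lemma barron_jensen_sup f x t L r p tau : 0 < t < T -> 0 < r ->
  (forall y s, enorm (y - x) <= r -> `|s - t| <= r -> st_cont f y s) ->
  (forall y s q sigma, enorm (y - x) < r -> `|s - t| < r -> prox_sub f y s q sigma ->
     enorm q <= L /\ sigma + lam * f y s + H0 y s q <= 0) ->
  fsup f x t p tau -> tau + lam * f x t + H0 x t p <= 0.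
Proof.
move=> tT r0 fc jets fs; apply/ler_addgt0Pr => e e0.
have fx : st_cont f x t by apply: fc; rewrite subrr ?enorm0 ?normr0 ltW.
have [v [r1 r10 rP]] := local_speed L p tT fx e0.
have m0 : 0 < Num.min r r1 by rewrite lt_min r0.
suff : tau + vdot v p <= vdot v p - lam * f x t - H0 x t p + e by lra.
apply: (sub_jets_sup m0 _ _ fs) => [y s|y s q sigma].
  by rewrite !le_min => /andP[yr _] /andP[sr _]; exact: fc.
rewrite !lt_min => /andP[yr yr1] /andP[sr sr1] /(jets _ _ _ _ yr sr)[qL].
exact: rP.
Qed.

End BarronJensen.

(** * Second-order expansions *)

Section Taylor.
Context {R : realType} {n : nat}.
Implicit Types (x y p q a : 'rV[R]_n) (s t tau c : R) (F : 'rV[R]_n -> R -> R).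

(** A first-order expansion with quadratic remainder: it is stable under the sums, products and
    [psq] that form the penalties, and a touching function with such an expansion yields a proximal
    jet. *)
Definition taylor2 F x t p tau := exists C, exists2 r, 0 < r &
  forall y s, enorm (y - x) < r -> `|s - t| < r ->
    `|F y s - F x t - vdot p (y - x) - tau * (s - t)|
      <= C * (enorm (y - x) + `|s - t|) ^+ 2.

Lemma taylor2_cst c x t : taylor2 (fun _ _ => c) x t 0 0.
Proof.
exists 0, 1 => // y s _ _; rewrite vdot0l !mul0r subrr !subr0 normr0.
exact: lexx.
Qed.

Lemma taylor2_sqr a x t :
  taylor2 (fun y _ => vdot (y - a) (y - a)) x t (2 *: (x - a)) 0.
Proof.
exists 1, 1 => // y s _ _; rewrite mul0r subr0 mul1r.
have -> : y - a = (y - x) + (x - a) by rewrite addrA subrK.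
move: (y - x) (x - a) => d w; rewrite [X in `|X|](_ : _ = vdot d d); last first.
  by rewrite !vdotE (vdotC d w); ring.
rewrite ger0_norm ?vdot_ge0// -enorm_sqr ler_pXn2r ?nnegrE ?addr_ge0 ?enorm_ge0//.
by rewrite lerDl.
Qed.

Lemma taylor2_time_sqr c x t : taylor2 (fun _ s => (s - c) ^+ 2) x t 0 (2 * (t - c)).
Proof.
exists 1, 1 => // y s _ _; rewrite vdot0l subr0 mul1r.
rewrite [X in `|X|](_ : _ = (s - t) ^+ 2); last by ring.
rewrite ger0_norm ?sqr_ge0// -(real_normK (num_real (s - t))).
by rewrite ler_pXn2r ?nnegrE ?addr_ge0 ?enorm_ge0// lerDr enorm_ge0.
Qed.

(** From 1 - z <= exp (- z) follows exp z <= 1 / (1 - z), so the remainder lies between 0 and z^2 /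
    (1 - z). *)
Lemma expR_taylor (z : R) : `|z| <= 1 / 2 -> `|expR z - 1 - z| <= 2 * z ^+ 2.
Proof.
move=> /ler_normlP[z1 z2]; have := expR_ge1Dx z; have := expR_ge1Dx (- z).
rewrite expRN => h1 h2; rewrite ger0_norm; last by lra.
have e0 := expR_gt0 z.
have : expR z * (1 - z) <= 1 by rewrite -ler_pdivlMl// mulr1.
by nra.
Qed.

Lemma taylor2_expR c x t : taylor2 (fun _ s => expR (c * s)) x t 0 (c * expR (c * t)).
Proof.
have c1 : 0 < 2 * (`|c| + 1) by rewrite mulr_gt0// ltr_wpDl.
exists (expR (c * t) * (2 * c ^+ 2)), (1 / (2 * (`|c| + 1))); first by rewrite divr_gt0.
move=> y s _; rewrite ltr_pdivlMr// => st; rewrite vdot0l subr0.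
have -> : expR (c * s) = expR (c * t) * expR (c * (s - t)).
  by rewrite -expRD; congr expR; ring.
have /expR_taylor h : `|c * (s - t)| <= 1 / 2.
  by rewrite normrM; have := normr_ge0 (s - t); nra.
rewrite [X in `|X|](_ : _ = expR (c * t) * (expR (c * (s - t)) - 1 - c * (s - t)));
  last by ring.
rewrite normrM (ger0_norm (expR_ge0 _)) -!mulrA ler_wpM2l ?expR_ge0//.
apply: le_trans h _.
have : (s - t) ^+ 2 <= (enorm (y - x) + `|s - t|) ^+ 2.
  rewrite -(real_normK (num_real (s - t))).
  by rewrite ler_pXn2r ?nnegrE ?addr_ge0 ?enorm_ge0// lerDr enorm_ge0.
move/(ler_wpM2l (sqr_ge0 c)); rewrite exprMn; lra.
Qed.

Lemma taylor2D F G x t p tau q sigma : taylor2 F x t p tau -> taylor2 G x t q sigma ->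
  taylor2 (fun y s => F y s + G y s) x t (p + q) (tau + sigma).
Proof.
move=> [C [r r0 hF]] [D [d d0 hG]]; exists (C + D), (Num.min r d).
  by rewrite lt_min r0.
move=> y s; rewrite !lt_min => /andP[yr yd] /andP[sr sd].
have := hF y s yr sr; have := hG y s yd sd.
move=> h1 h2; rewrite vdotDl; set X := (X in `|X|).
have -> : X = (F y s - F x t - vdot p (y - x) - tau * (s - t))
  + (G y s - G x t - vdot q (y - x) - sigma * (s - t)) by rewrite /X; ring.
by apply: le_trans (ler_normD _ _) _; rewrite mulrDl lerD.
Qed.

Lemma taylor2_lip F x t p tau : taylor2 F x t p tau -> exists2 M, 0 <= M &
  exists2 r, 0 < r & forall y s, enorm (y - x) < r -> `|s - t| < r ->
    `|F y s - F x t| <= M * (enorm (y - x) + `|s - t|).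
Proof.
move=> [C [r r0 hF]]; exists (enorm p + `|tau| + `|C|).
  by rewrite !addr_ge0 ?enorm_ge0.
exists (Num.min r (1 / 2)); first by rewrite lt_min r0/=; lra.
move=> y s; rewrite !lt_min => /andP[yr y1] /andP[sr s1].
have := hF y s yr sr; have := vdot_abs p (y - x); have : `|tau * (s - t)| <= `|tau| * `|s - t|.
  by rewrite normrM.
have := enorm_ge0 (y - x); have := normr_ge0 (s - t); have := enorm_ge0 p.
have := normr_ge0 tau; have := ler_norm C; have := normr_ge0 C.
move: (enorm (y - x)) `|s - t| (enorm p) y1 s1 => a b P a1 b1 C0 CC t0 P0 b0 a0 h1 h2 h3.
have {h3} h3 : `|F y s - F x t - vdot p (y - x) - tau * (s - t)| <= `|C| * (a + b).
  apply: le_trans h3 _; apply: (@le_trans _ _ (`|C| * (a + b) ^+ 2)).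
    by rewrite ler_wpM2r// sqr_ge0.
  by rewrite ler_wpM2l// expr2 ler_piMl//; lra.
move: h1 h2 h3; rewrite !ler_norml => /andP[? ?] /andP[? ?] /andP[? ?].
have ? : P * a <= P * (a + b) by rewrite ler_wpM2l// lerDl.
have ? : `|tau| * b <= `|tau| * (a + b) by rewrite ler_wpM2l// lerDr.
apply/andP; split; lra.
Qed.

Lemma taylor2M F G x t p tau q sigma : taylor2 F x t p tau -> taylor2 G x t q sigma ->
  taylor2 (fun y s => F y s * G y s) x t (F x t *: q + G x t *: p)
    (F x t * sigma + G x t * tau).
Proof.
move=> tF tG; have [M1 M10 [r1 r10 h1]] := taylor2_lip tF.
have [M2 M20 [r2 r20 h2]] := taylor2_lip tG.
move: tF tG => [C [r r0 hF]] [D [d d0 hG]].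
exists (M1 * M2 + `|F x t| * D + `|G x t| * C), (Num.min (Num.min r d) (Num.min r1 r2)).
  by rewrite !lt_min r0 d0 r10.
move=> y s; rewrite !lt_min => /andP[/andP[yr yd] /andP[y1 y2]] /andP[/andP[sr sd] /andP[s1 s2]].
have := hF y s yr sr; have := hG y s yd sd; have := h1 y s y1 s1; have := h2 y s y2 s2.
set b := enorm _ + _ => k2 k1 kG kF.
set X := (X in `|X|); have -> : X = (F y s - F x t) * (G y s - G x t)
   + F x t * (G y s - G x t - vdot q (y - x) - sigma * (s - t))
   + G x t * (F y s - F x t - vdot p (y - x) - tau * (s - t)).
  by rewrite /X vdotDl !vdotZl; ring.
rewrite [leRHS]mulrDl [in leRHS](mulrDl _ _ (b ^+ 2)).
apply: le_trans (ler_normD _ _) _; apply: lerD; last first.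
  by rewrite normrM -mulrA ler_wpM2l.
apply: le_trans (ler_normD _ _) _; apply: lerD; last first.
  by rewrite normrM -mulrA ler_wpM2l.
rewrite normrM expr2 mulrACA; exact: ler_pM.
Qed.

Lemma taylor2Z c F x t p tau : taylor2 F x t p tau ->
  taylor2 (fun y s => c * F y s) x t (c *: p) (c * tau).
Proof.
move=> tF; have := taylor2M (taylor2_cst c x t) tF.
by rewrite scaler0 addr0 mulr0 addr0.
Qed.

Lemma taylor2_psq F x t p tau : taylor2 F x t p tau ->
  let z := F x t + `|F x t| in taylor2 (fun y s => psq (F y s)) x t (z *: p) (z * tau).
Proof.
move=> tF z; have [M M0 [r1 r10 h1]] := taylor2_lip tF.
move: tF => [C [r r0 hF]]; exists (M ^+ 2 + `|z| * C), (Num.min r r1).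
  by rewrite lt_min r0.
move=> y s; rewrite !lt_min => /andP[yr y1] /andP[sr s1].
have := hF y s yr sr; have := h1 y s y1 s1; have := psq_taylor (F x t) (F y s).
rewrite -/z; set b := enorm _ + _ => k1 k2 k3.
set X := (X in `|X|).
have -> : X = (psq (F y s) - psq (F x t) - z * (F y s - F x t))
   + z * (F y s - F x t - vdot p (y - x) - tau * (s - t)).
  by rewrite /X vdotZl; ring.
apply: le_trans (ler_normD _ _) _; rewrite [leRHS]mulrDl; apply: lerD.
  apply: le_trans k1 _; rewrite -exprMn -(real_normK (num_real (F y s - F x t))).
  by rewrite ler_pXn2r ?nnegrE//; apply: le_trans k2.
by rewrite normrM -mulrA ler_wpM2l.
Qed.

Lemma taylor2_prox_sub f F x t p tau r : 0 < r -> taylor2 F x t p tau ->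
  (forall y s, enorm (y - x) < r -> `|s - t| < r -> f x t + F x t <= f y s + F y s) ->
  prox_sub f x t (- p) (- tau).
Proof.
move=> r0 [C [d d0 hF]] fF; exists C, (Num.min r d); first by rewrite lt_min r0.
move=> y s; rewrite !lt_min => /andP[yr yd] /andP[sr sd].
have := fF y s yr sr; have /ler_normlP[_] := hF y s yd sd.
by rewrite vdotNl; lra.
Qed.

End Taylor.

(** * Comparison in a cone *)

Section UniformContinuity.
Context {R : realType} {n : nat} (T : R).
Implicit Types (x y z p q : 'rV[R]_n) (s t d : R) (f : 'rV[R]_n -> R -> R).

Lemma cont_st0_cvg f (I : Type) (F : set_system I) (FF : Filter F)
    (hx : I -> 'rV[R]_n) (ht : I -> R) x t : cont_st0 T f -> 0 <= t < T ->
  hx @ F --> x -> ht @ F --> t -> (\forall i \near F, 0 <= ht i < T) ->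
  f (hx i) (ht i) @[i --> F] --> f x t.
Proof.
move=> fc tT hxx htt hT; apply/cvgrPdist_lt => e e0.
have [d d0 fd] := fc x t tT e e0.
have h1 := hxx _ (near_enorm x d0); have h2 := htt _ (near_abs t d0).
near=> i; rewrite distrC; apply: fd; near: i; [exact: hT | exact: h1 | exact: h2].
Unshelve. all: by end_near. Qed.

(** For excluding maxima of the doubled function at which one of the two times is 0 and the other
    merely small. *)
Lemma cont_st0_unif0 f x0 rho eta : 0 < T -> cont_st0 T f -> 0 < eta ->
  exists2 d, 0 < d & forall z s, enorm (z - x0) <= rho -> 0 <= s < T -> s < d ->
    `|f z s - f z 0| < eta.
Proof.
move=> T0 fc eta0.
pose P d z := forall s, 0 <= s < T -> s < d -> `|f z s - f z 0| < eta.
have [d d0 dP] : exists2 d, 0 < d & forall z, [set z | enorm (z - x0) <= rho] z -> P d z.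
  apply: compact_uniform; first exact: compact_eball.
    by move=> d d' z d'0 d'd Pd s sT sd; apply: Pd => //; exact: lt_le_trans d'd.
  move=> z _; have z0T : 0 <= (0 : R) < T by rewrite lexx.
  have [d d0 fd] := fc z 0 z0T (eta / 2) (divr_gt0 eta0 (ltr0n R 2)).
  exists d => //; apply: filterS (near_enorm z d0) => y yz _ s sT sd.
  have := fd y s sT yz; have := fd y 0 z0T yz.
  rewrite subrr subr0 normr0 (@ger0_norm _ s); last by case/andP: sT.
  by move=> /(_ d0) h1 /(_ sd); move: h1; rewrite !ltr_norml; lra.
by exists d => // z s zr; apply: dP.
Qed.

(** Doubling the variables produces two different times; changes of position and momentum have
    Lipschitz bounds, and this handles the change of time. *)
Lemma cont_H_time_unif (H0 : 'rV[R]_n -> R -> 'rV[R]_n -> R) x0 rho L eta :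
  cont_H T H0 -> 0 < eta ->
  exists2 d, 0 < d & forall x t s p, enorm (x - x0) <= rho -> enorm p <= L ->
    0 <= t <= T -> 0 <= s <= T -> `|s - t| < d -> `|H0 x s p - H0 x t p| < eta.
Proof.
move=> Hc eta0.
pose P d (w : ('rV[R]_n * R) * 'rV[R]_n) := forall s, 0 <= s <= T -> `|s - w.1.2| < d ->
  `|H0 w.1.1 s w.2 - H0 w.1.1 w.1.2 w.2| < eta.
pose A := ([set x | enorm (x - x0) <= rho] `*` `[0, T]%classic)
  `*` [set p : 'rV[R]_n | enorm (p - 0) <= L].
have cA : compact A.
  apply: compact_setX; last exact: compact_eball.
  by apply: compact_setX; [exact: compact_eball | exact: segment_compact].
have [d d0 dP] : exists2 d, 0 < d & forall w, A w -> P d w.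
  apply: (compact_uniform cA).
    by move=> d d' w d'0 d'd Pd s sT sd; apply: Pd => //; exact: lt_le_trans d'd.
  move=> [[x t] p] [[_ /=]]; rewrite in_itv/= => tT _.
  have [d d0 hd] := Hc x t p tT (eta / 2) (divr_gt0 eta0 (ltr0n R 2)).
  have d20 : 0 < d / 2 by lra.
  exists (d / 2) => //.
  exists ([set y | enorm (y.1 - x) < d / 2 /\ `|y.2 - t| < d / 2],
          [set q | enorm (q - p) < d]).
    by split => /=; [exact: near_st | exact: near_enorm].
  move=> [[y s] q] [[/= ys st] qp] [[_ /=]]; rewrite in_itv/= => sT _ a /= aT as_.
  have yd : enorm (y - x) < d by lra.
  have sd : `|s - t| < d by lra.
  have ad : `|a - t| < d by move: as_ st; rewrite !ltr_norml; lra.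
  have := hd y a q aT yd ad qp; have := hd y s q sT yd sd qp.
  by rewrite !ltr_norml; lra.
exists d => // x t s p xr pL tT sT st.
by apply: (dP ((x, t), p)) => //; split => /=; [split => //=; rewrite in_itv | rewrite subr0].
Qed.

End UniformContinuity.

(** The contradiction at the maximum of the doubled function. As N^-1 <= gam, d <= N d^2 + N^-1 <=
    Q. In |lam| + 3 C1 + 1, one C1 absorbs beta d, two absorb 2 N d^2, |lam| absorbs lam, and the
    last 1 leaves kap Q <= omega < gam <= Q. *)
Lemma comparison_algebra {R : realType} (lam C1 beta kap Q N gam d e B omega : R)
    (fz gx Hz Hx : R) :
  0 <= C1 -> 0 <= beta <= 1 -> 1 <= kap -> 0 < N -> N^-1 <= gam -> 0 <= d ->
  N * d ^+ 2 + gam <= Q -> fz - gx = kap * Q ->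
  e + lam * fz + Hz <= 0 ->
  0 <= - (kap * ((`|lam| + 3 * C1 + 1) * Q + B)) + e + lam * gx + Hx ->
  Hx - Hz <= C1 * (beta + 2 * kap * N * d) * d + omega + kap * B -> omega < gam -> False.
Proof.
move=> C10 /andP[b0 b1] k1 N0 Ng d0 Qd fg sub sup dH og.
have g0 : 0 < gam by rewrite (lt_le_trans _ Ng)// invr_gt0.
have Nd0 : 0 <= N * d ^+ 2 by rewrite mulr_ge0 ?sqr_ge0 ?(ltW N0).
have Q0 : 0 < Q by lra.
have kQ : Q <= kap * Q by rewrite ler_peMl// ltW.
have dQ : d <= Q.
  apply: le_trans Qd; apply: (@le_trans _ _ (N * d ^+ 2 + N^-1)); last by rewrite lerD2l.
  rewrite -(ler_pM2l N0) mulrDr divff ?gt_eqF//.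
  by have := sqr_ge0 (N * d - 1 / 2); nra.
have h1 : C1 * (beta * d) <= C1 * (kap * Q).
  rewrite ler_wpM2l// (le_trans _ kQ)// (le_trans _ dQ)//.
  by rewrite ler_piMl.
have h2 : C1 * (kap * (N * d ^+ 2)) <= C1 * (kap * Q).
  by rewrite ler_wpM2l// ler_wpM2l//; lra.
have h3 : 0 <= (`|lam| + lam) * (kap * Q).
  by rewrite mulr_ge0//; [have := ler_norm (- lam); rewrite normrN; lra | lra].
have : lam * fz - lam * gx = lam * (kap * Q) by rewrite -fg; ring.
lra.
Qed.

(** Doubling of variables with a quotient: if the claim fails, exp (- K t) (f - g) / Q exceeds 1 at
    its maximum, where f - g is then a multiple kap > 1 of Q. As f - g <= 2 S there, every penalty
    in Q is at most 2 S, which localizes the maximum. The modulus N |z - x|^2 + gam is carried from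
    time 0 to [t0], so the statement serves both as a Lipschitz estimate and as a comparison
    principle. *)
Lemma comparison {R : realType} {n : nat} (T lam C1 beta A2 B2 : R)
    (H0 : 'rV[R]_n -> R -> 'rV[R]_n -> R) (f g : 'rV[R]_n -> R -> R)
    (x0 : 'rV[R]_n) (t0 t' A th del S N gam0 gam : R) :
  0 <= C1 -> 0 <= beta <= 1 -> 0 <= A2 -> 0 <= B2 -> cont_H T H0 ->
  (forall x y t p, 0 <= t <= T ->
    `|H0 x t p - H0 y t p| <= C1 * (beta + enorm p) * enorm (x - y)) ->
  (forall x t p q, 0 <= t <= T ->
    `|H0 x t p - H0 x t q| <= (A2 * enorm x + B2) * enorm (p - q)) ->
  cont_st0 T f -> cont_st0 T g ->
  (forall x t p tau, 0 < t < T -> prox_sup f x t p tau ->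
    tau + lam * f x t + H0 x t p <= 0) ->
  (forall x t p tau, 0 < t < T -> prox_sub g x t p tau ->
    0 <= tau + lam * g x t + H0 x t p) ->
  0 < t0 -> t0 < t' -> t' < T -> 0 < A -> A2 <= A -> 0 < th -> 0 < del -> 0 < N ->
  gam0 < gam -> N^-1 <= gam ->
  let r0 := th * expR (A * t0) + (enorm x0 + B2 / A) * (expR (A * t0) - 1) in
  (forall z s, enorm (z - x0) <= r0 + del -> 0 <= s <= t' ->
     `|f z s| <= S /\ `|g z s| <= S) -> 2 * S < N * del ^+ 2 ->
  (forall x z, enorm (x - x0) <= r0 -> enorm (z - x0) <= r0 + del ->
     f z 0 - g x 0 <= N * vdot (z - x) (z - x) + gam0) ->
  forall z, enorm (z - x0) <= del ->
    f z t0 - g x0 t0 <= expR ((`|lam| + 3 * C1 + 1) * t0) * (N * vdot (z - x0) (z - x0) + gam).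
Proof.
set K := `|lam| + 3 * C1 + 1; move=> C10 beta01 A20 B20 contH lipx lipp fc gc fsubsol gsupersol t00 t0t' t'T A0 A2A th0 del0 N0 gam01 Ngam r0 bnd SN init zi zidel.
rewrite leNgt; apply/negP => lt.
have gam_0 : 0 < gam by rewrite (lt_le_trans _ Ngam)// invr_gt0.
have T0 : 0 < T by lra.
have K0 : 0 < K by rewrite ltr_wpDl// addr_ge0// mulr_ge0.
pose D := enorm x0 + B2 / A.
have D0 : 0 <= D by rewrite addr_ge0 ?enorm_ge0 ?divr_ge0 ?(ltW A0).
have AD : A * D = A * enorm x0 + B2 by rewrite /D; field; rewrite gt_eqF.
pose W := (th + D) * expR (A * t0).
have thD0 : 0 < th + D by lra.
have W0 : 0 < W by rewrite mulr_gt0// expR_gt0.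
(* The radius of the cone: G' = - A (G + D), and A (G + D) = A (G + |x0|) + B2 bounds the
   propagation speed A2 |x| + B2 on the ball of radius G around x0. *)
pose G s := W * expR (- A * s) + - D.
have G0 : G 0 = r0 by rewrite /G mulr0 expR0 mulr1 /W /r0 -/D; ring.
have Gt0 : G t0 = th by rewrite /G /W -mulrA -expRD mulNr addrN expR0; ring.
(* [t1] lies beyond [t0], so that the maximum can be kept away from the final time, but close enough
   for the radius [G t1] to stay positive. *)
pose h := Num.min (t' - t0) (th / ((th + D) * A)) / 2.
have h0 : 0 < h.
  by rewrite divr_gt0// lt_min subr_gt0 t0t' divr_gt0// mulr_gt0.
pose t1 := t0 + h.
have t1t' : t1 < t'.
  have : Num.min (t' - t0) (th / ((th + D) * A)) <= t' - t0 by rewrite ge_min lexx.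
  by rewrite /t1 /h; lra.
have hA : (th + D) * A * h < th.
  have : Num.min (t' - t0) (th / ((th + D) * A)) <= th / ((th + D) * A).
    by rewrite ge_min lexx orbT.
  by rewrite ler_pdivlMr ?mulr_gt0// /h; lra.
have Gt1 : G t1 = (th + D) * expR (- (A * h)) - D.
  by rewrite /G /W -mulrA -expRD; congr (_ * expR _ - _); rewrite /t1; ring.
have G10 : 0 < G t1.
  by rewrite Gt1; have := ler_wpM2l (ltW thD0) (expR_ge1Dx (- (A * h))); lra.
have G1th : G t1 < th.
  have : expR (- (A * h)) < 1 by rewrite -expR0 ltr_expR oppr_lt0 mulr_gt0.
  by rewrite -(ltr_pM2l thD0) Gt1; lra.
have Gmono s t : s <= t -> G t <= G s.
  by move=> st; rewrite lerD2r ler_pM2l// ler_expR !mulNr lerN2 ler_pM2l.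
have r00 : 0 < r0 by rewrite -G0; apply: lt_le_trans G10 _; apply: Gmono; rewrite /t1; lra.
have gap0 : 0 < (gam - gam0) / 2 by rewrite divr_gt0// subr_gt0.
have [df df0 ufP] := cont_st0_unif0 x0 (r0 + del) T0 fc gap0.
have [dg dg0 ugP] := cont_st0_unif0 x0 (r0 + del) T0 gc gap0.
have [dH dH0 uHP] := cont_H_time_unif x0 r0 (2 * (2 * S / gam) * N * del) contH gam_0.
pose d := Num.min (Num.min df dg) (Num.min dH (t' - t1)).
have d0 : 0 < d by rewrite !lt_min df0 dg0 dH0 subr_gt0.
have S0 : 0 <= S.
  have [h1 _] : `|f x0 0| <= S /\ `|g x0 0| <= S.
    apply: bnd; first by rewrite subrr enorm0 addr_ge0 ?ltW.
    by rewrite lexx/= ltW// (lt_trans t00).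
  by apply: le_trans h1.
(* [E] and [M] push a penalty above 2 S once the two times are [d] apart, respectively once [arg]
   reaches [gg]. *)
pose E := (2 * S + 1) / d ^+ 2.
have E0 : 0 < E by rewrite divr_gt0 ?exprn_gt0// ltr_wpDl// mulr_ge0.
have Ed : E * d ^+ 2 = 2 * S + 1 by rewrite divfK// gt_eqF// exprn_gt0.
pose gg := th ^+ 2 - G t1 ^+ 2.
have gg0 : 0 < gg by rewrite subr_gt0 ltr_pXn2r// ?nnegrE ltW.
pose M := (2 * S + 1) / gg ^+ 2.
have M0 : 0 < M by rewrite divr_gt0 ?exprn_gt0// ltr_wpDl// mulr_ge0.
have Mgg : M * gg ^+ 2 = 2 * S + 1 by rewrite divfK// gt_eqF// exprn_gt0.
clearbody E M.
(* The shift by th^2 makes [arg] vanish at (x0, t0), which pays no penalty; yet arg < gg on [0, t1]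
   forces |x - x0| < G t and t < t1. *)
pose arg x t := vdot (x - x0) (x - x0) + (-1) * (G t * G t) + th ^+ 2.
pose Q (w : ('rV[R]_n * R) * ('rV[R]_n * R)) :=
  N * vdot (w.2.1 - w.1.1) (w.2.1 - w.1.1) + gam + M * psq (arg w.2.1 w.2.2)
  + E * (w.2.2 - w.1.2) ^+ 2.
have Mpsq w : 0 <= M * psq w by rewrite mulr_ge0 ?psq_ge0 ?(ltW M0).
have Q0 w : 0 < Q w.
  have := mulr_ge0 (ltW N0) (vdot_ge0 (w.2.1 - w.1.1)).
  have := Mpsq (arg w.2.1 w.2.2); have := mulr_ge0 (ltW E0) (sqr_ge0 (w.2.2 - w.1.2)).
  by rewrite /Q; clear -gam_0; lra.
pose Psi (w : ('rV[R]_n * R) * ('rV[R]_n * R)) :=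
  expR (- K * w.2.2) * (f w.1.1 w.1.2 - g w.2.1 w.2.2) / Q w.
pose Om := ([set z | enorm (z - x0) <= r0 + del] `*` `[0, t']%classic) `*`
           ([set x | enorm (x - x0) <= r0] `*` `[0, t1]%classic).
have OmP z s x t : Om ((z, s), (x, t)) <->
    [/\ enorm (z - x0) <= r0 + del, 0 <= s <= t', enorm (x - x0) <= r0 & 0 <= t <= t1].
  rewrite /Om /=; split; last by move=> [? ? ? ?]; split; split=> //=; rewrite in_itv.
  by move=> [[/= ?]]; rewrite in_itv/= => ? [/= ?]; rewrite in_itv.
have cOm : compact Om.
  by apply: compact_setX; apply: compact_setX; first
    [exact: compact_eball | exact: segment_compact].
have Omi : Om ((zi, t0), (x0, t0)).
  apply/OmP; rewrite subrr enorm0; split.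
  - by clear -zidel r00; lra.
  - by rewrite (ltW t00) ltW.
  - exact: ltW.
  - by rewrite (ltW t00) lerDl ltW.
have Psic w : Om w -> Psi y @[y --> within Om (nbhs w)] --> Psi w.
  case: w => -[z s] [x t] Omw; have [zr st xr tt] := (OmP _ _ _ _).1 Omw.
  set F := within _ _; have FF : Filter F by exact: within_filter.
  have cz : y.1.1 @[y --> F] --> z.
    by apply: cvg_within_filter; exact: (cvg_comp _ _ cvg_fst cvg_fst).
  have cs : y.1.2 @[y --> F] --> s.
    by apply: cvg_within_filter; exact: (cvg_comp _ _ cvg_fst cvg_snd).
  have cx : y.2.1 @[y --> F] --> x.
    by apply: cvg_within_filter; exact: (cvg_comp _ _ cvg_snd cvg_fst).
  have ct : y.2.2 @[y --> F] --> t.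
    by apply: cvg_within_filter; exact: (cvg_comp _ _ cvg_snd cvg_snd).
  have inOm : \forall y \near F, Om y by exact: withinT.
  have cf : f y.1.1 y.1.2 @[y --> F] --> f z s.
    have sT : 0 <= s < T by clear -st t'T; lra.
    apply: (cont_st0_cvg FF fc sT cz cs).
    by apply: filterS inOm => -[[? ?] [? ?]] /OmP[_ + _ _] /=; clear -t'T; lra.
  have cg : g y.2.1 y.2.2 @[y --> F] --> g x t.
    have tT : 0 <= t < T by clear -tt t'T t1t'; lra.
    apply: (cont_st0_cvg FF gc tT cx ct).
    by apply: filterS inOm => -[[? ?] [? ?]] /OmP[_ _ _ +] /=; clear -t'T t1t'; lra.
  have ce a : expR (a * y.2.2) @[y --> F] --> expR (a * t).
    have cat : a * y.2.2 @[y --> F] --> a * t by apply: cvgM => //; exact: cvg_cst.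
    have ec : expR u @[u --> a * t] --> expR (a * t) by exact: continuous_expR.
    exact: (cvg_comp _ _ cat ec).
  have cG : G y.2.2 @[y --> F] --> G t.
    by apply: cvgD; [apply: cvgM; [exact: cvg_cst | exact: ce] | exact: cvg_cst].
  have cxz : y.2.1 - y.1.1 @[y --> F] --> x - z by exact: cvgB.
  have cxx : y.2.1 - x0 @[y --> F] --> x - x0 by apply: cvgB => //; exact: cvg_cst.
  have cts : y.2.2 - y.1.2 @[y --> F] --> t - s by exact: cvgB.
  have carg : arg y.2.1 y.2.2 @[y --> F] --> arg x t.
    apply: cvgD; last exact: cvg_cst.
    apply: cvgD; first exact: (cvg_vdot cxx cxx).
    by apply: cvgM; [exact: cvg_cst | exact: cvgM].
  apply: cvgM; first by apply: cvgM; [exact: ce | exact: cvgB].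
  apply: cvgV; first by rewrite gt_eqF// Q0.
  apply: cvgD; last by apply: cvgM; [exact: cvg_cst | exact: cvgM].
  apply: cvgD; last first.
    apply: cvgM; [exact: cvg_cst |].
    have pc : psq u @[u --> arg x t] --> psq (arg x t) by exact: continuous_psq.
    exact: (cvg_comp _ _ carg pc).
  apply: cvgD; last exact: cvg_cst.
  by apply: cvgM; [exact: cvg_cst | exact: (cvg_vdot cxz cxz)].
have [[[zm sm] [xm tm]] Omm Pmax] := compact_max_within cOm (ex_intro _ _ Omi) Psic.
set r := Psi ((zm, sm), (xm, tm)) in Pmax.
have r1 : 1 < r.
  apply: lt_le_trans (Pmax _ Omi).
  have Qi : Q ((zi, t0), (x0, t0)) = N * vdot (zi - x0) (zi - x0) + gam.
    rewrite /Q /arg /= !subrr vdot0r Gt0 psq_neg; last by rewrite mulN1r -expr2 add0r addNr.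
    by rewrite mulr0 expr0n/= mulr0 !addr0 -(opprB zi) vdotNl vdotNr opprK.
  rewrite /Psi ltr_pdivlMr; last exact: Q0.
  by rewrite mul1r Qi mulNr expRN ltr_pdivlMl// expR_gt0.
have [zr /andP[s0 st'] xr /andP[t0' tt1]] := (OmP _ _ _ _).1 Omm.
set Qm := Q ((zm, sm), (xm, tm)).
pose kap := r * expR (K * tm).
have fg : f zm sm - g xm tm = kap * Qm.
  rewrite /kap /r /Psi -/Qm /= mulNr expRN; field.
  by rewrite !gt_eqF ?expR_gt0 ?Q0.
have fgle z s x t : Om ((z, s), (x, t)) ->
    f z s - g x t <= r * (expR (K * t) * Q ((z, s), (x, t))).
  move=> /Pmax; rewrite {1}/Psi ler_pdivrMr ?Q0//= mulNr expRN ler_pdivrMl ?expR_gt0//.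
  by rewrite mulrCA.
have kap1 : 1 < kap.
  have : 1 <= expR (K * tm) by rewrite -expR0 ler_expR mulr_ge0// ltW.
  by rewrite /kap; move: (expR _) => e; clear -r1; nra.
have kap0 : 0 <= kap by apply: ltW; exact: lt_trans ltr01 kap1.
have QmE : Qm = N * vdot (xm - zm) (xm - zm) + gam + M * psq (arg xm tm) + E * (tm - sm) ^+ 2.
  by [].
have Q0m : 0 < Qm by exact: Q0.
have fg2S : kap * Qm <= 2 * S.
  rewrite -fg; have [h1 _] := bnd zm sm zr (introT andP (conj s0 st')).
  have [_ h2] : `|f xm tm| <= S /\ `|g xm tm| <= S.
    apply: bnd; first by apply: le_trans xr _; rewrite lerDl ltW.
    by rewrite t0'/= (le_trans tt1)// ltW.
  by move: h1 h2; clear; rewrite !ler_norml; lra.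
have Qm2S : Qm <= 2 * S.
  by apply: le_trans fg2S; rewrite ler_peMl// ltW.
have n0 : 0 <= N * vdot (xm - zm) (xm - zm) by rewrite mulr_ge0 ?vdot_ge0 ?(ltW N0).
have p0 := Mpsq (arg xm tm).
have e0 : 0 <= E * (tm - sm) ^+ 2 by rewrite mulr_ge0 ?sqr_ge0 ?(ltW E0).
have xz : enorm (xm - zm) < del.
  rewrite ltNge; apply/negP => le; suff : N * del ^+ 2 <= 2 * S by clear -SN; lra.
  apply: le_trans Qm2S; apply: (@le_trans _ _ (N * vdot (xm - zm) (xm - zm))).
    by rewrite -enorm_sqr ler_pM2l// ler_pXn2r ?nnegrE ?enorm_ge0// ltW.
  by rewrite QmE; clear -p0 e0 gam_0; lra.
have ts : `|tm - sm| < d.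
  rewrite ltNge; apply/negP => le; suff : E * d ^+ 2 <= 2 * S by clear -Ed; lra.
  apply: le_trans Qm2S; apply: (@le_trans _ _ (E * (tm - sm) ^+ 2)).
    by rewrite -[X in _ <= E * X]real_normK ?num_real// ler_pM2l// ler_pXn2r ?nnegrE// ltW.
  by rewrite QmE; clear -p0 n0 gam_0; lra.
have argle : arg xm tm < gg.
  rewrite ltNge; apply/negP => le; suff : M * gg ^+ 2 <= 2 * S by clear -Mgg; lra.
  apply: le_trans Qm2S; apply: (@le_trans _ _ (M * psq (arg xm tm))).
    have a0 : 0 <= arg xm tm by apply: le_trans le; exact: ltW.
    by rewrite ler_pM2l// (psq_pos a0) ler_pXn2r ?nnegrE// ltW.
  by rewrite QmE; clear -n0 e0 gam_0; lra.
have Gtm0 : 0 < G tm by apply: lt_le_trans (Gmono _ _ tt1).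
have xG : enorm (xm - x0) < G tm.
  rewrite -(@ltr_pXn2r _ 2)// ?nnegrE ?enorm_ge0 ?(ltW Gtm0)// enorm_sqr.
  by have := sqr_ge0 (G t1); move: argle; rewrite /arg /gg; clear; lra.
have tmt1 : tm < t1.
  rewrite lt_neqAle tt1 andbT; apply/eqP => te.
  by have := vdot_ge0 (xm - x0); move: argle; rewrite /arg /gg te; clear; lra.
have {ts} [ts1 ts2] : `|tm - sm| < t' - t1 /\ `|tm - sm| < Num.min (Num.min df dg) dH.
  by move: ts; rewrite /d !lt_min => /andP[/andP[-> ->] /andP[-> ->]].
move: ts2; rewrite !lt_min => /andP[/andP[tsf tsg] tsH].
have smt' : sm < t' by move: ts1; rewrite ltr_norml; clear -tt1; lra.
have Gtm : G tm <= r0 by rewrite -G0; exact: Gmono.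
have zr' : enorm (zm - x0) < r0 + del.
  by have := enorm_tri xm zm x0; rewrite (enormBC zm xm); clear -xG xz Gtm; lra.
have xr' : enorm (xm - x0) < r0 by exact: lt_le_trans Gtm.
(* If one time is 0, both are small, so f - g exceeds its initial value by less than gam - gam0 and
   stays below N |z - x|^2 + gam <= Q, against f - g = kap Q. *)
have notinit : tm = 0 \/ sm = 0 -> False.
  move=> ts0; have [sf tg] : sm < df /\ tm < dg.
    by move: tsf tsg; case: ts0 => ->; rewrite ?sub0r ?subr0 ?normrN ger0_norm.
  have xr2 : enorm (xm - x0) <= r0 + del by apply: le_trans xr _; rewrite lerDl ltW.
  have sT : 0 <= sm < T by rewrite s0 (lt_trans smt').
  have tT : 0 <= tm < T by rewrite t0' (lt_trans tmt1)// (lt_trans t1t').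
  have := ufP zm sm zr sT sf; have := ugP xm tm xr2 tT tg.
  have := init xm zm xr zr; rewrite -(opprB xm) vdotNl vdotNr opprK.
  have kQ : Qm <= kap * Qm by rewrite ler_peMl// ltW.
  by rewrite !ltr_norml; clear -kQ QmE p0 e0 fg; lra.
have tm0 : 0 < tm by rewrite lt_neqAle t0' andbT; apply/eqP => e; apply: notinit; left.
have sm0 : 0 < sm by rewrite lt_neqAle s0 andbT; apply/eqP => e; apply: notinit; right.
have jetf : prox_sup f zm sm ((2 * kap * N) *: (zm - xm)) (2 * kap * E * (sm - tm)).
  exists (kap * (N + E)), (Num.min (r0 + del - enorm (zm - x0)) (Num.min sm (t' - sm))).
    by rewrite !lt_min !subr_gt0 zr' sm0.
  move=> z s; rewrite !lt_min => /andP[zz _] /andP[_ /andP[ss1 ss2]].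
  have Omz : Om ((z, s), (xm, tm)).
    have := enorm_tri zm z x0; move: ss1 ss2; rewrite !ltr_norml => h1 h2 h3.
    apply/OmP; split; [by clear -zz h3; lra | by clear -h1 h2; lra | exact: ltW |].
    by rewrite t0' ltW.
  have := fgle _ _ _ _ Omz; rewrite mulrA -/kap /Q /=.
  move: fg; rewrite QmE.
  have -> : xm - zm = - (zm - xm) by rewrite opprB.
  have -> : xm - z = - ((z - zm) + (zm - xm)) by rewrite addrA subrK opprB.
  have sq : (s - sm) ^+ 2 <= (enorm (z - zm) + `|s - sm|) ^+ 2.
    rewrite -(real_normK (num_real (s - sm))) ler_pXn2r ?nnegrE ?addr_ge0 ?enorm_ge0//.
    by rewrite lerDr enorm_ge0.
  have dd : vdot (z - zm) (z - zm) <= (enorm (z - zm) + `|s - sm|) ^+ 2.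
    rewrite -enorm_sqr ler_pXn2r ?nnegrE ?addr_ge0 ?enorm_ge0//.
    by rewrite lerDl.
  move: (enorm (z - zm) + `|s - sm|) (z - zm) (zm - xm) sq dd => b d' w sq dd.
  have kN : 0 <= kap * N by exact: mulr_ge0 (ltW N0).
  have kE : 0 <= kap * E by exact: mulr_ge0 (ltW E0).
  have h1 := ler_wpM2l kN dd; have h2 := ler_wpM2l kE sq.
  by rewrite !vdotE (vdotC w d'); clear -h1 h2; lra.
(* Only the variables of [g] carry the factor exp (K t) and the cone penalty, so the damping and
   speed terms all appear in the subjet of [g], and the superjet of [f] stays simple. *)
have tG := taylor2D (taylor2Z W (taylor2_expR (- A) xm tm)) (taylor2_cst (- D) xm tm).
have targ := taylor2D (taylor2D (taylor2_sqr x0 xm tm) (taylor2Z (-1) (taylor2M tG tG)))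
   (taylor2_cst (th ^+ 2) xm tm).
have tF := taylor2Z r (taylor2M (taylor2_expR K xm tm) (taylor2D (taylor2D (taylor2D
   (taylor2Z N (taylor2_sqr zm xm tm)) (taylor2_cst gam xm tm))
   (taylor2Z M (taylor2_psq targ))) (taylor2Z E (taylor2_time_sqr sm xm tm)))).
have rg0 : 0 < Num.min (r0 - enorm (xm - x0)) (Num.min tm (t1 - tm)).
  by rewrite !lt_min !subr_gt0 xr' tm0.
have kapQ : r * (expR (K * tm) * Qm) = kap * Qm by rewrite /kap mulrA.
have tmT : 0 < tm < T by rewrite tm0 (lt_trans tmt1)// (lt_trans t1t').
have smT : 0 < sm < T by rewrite sm0 (lt_trans smt').
have tmT' : 0 <= tm <= T by case/andP: tmT => ? ?; rewrite !ltW.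
have smT' : 0 <= sm <= T by case/andP: smT => ? ?; rewrite !ltW.
have {tF} := @taylor2_prox_sub _ _ g _ _ _ _ _ _ rg0 tF.
set Pv := - (_ *: _); set tv := - (_ * _).
have prem : forall y t, enorm (y - xm) < Num.min (r0 - enorm (xm - x0)) (Num.min tm (t1 - tm)) ->
   `|t - tm| < Num.min (r0 - enorm (xm - x0)) (Num.min tm (t1 - tm)) ->
   g xm tm + r * (expR (K * tm) * Qm) <= g y t + r * (expR (K * t) * Q ((zm, sm), (y, t))).
  move=> y t; rewrite !lt_min => /andP[yy _] /andP[_ /andP[st1 st2]].
  have Omy : Om ((zm, sm), (y, t)).
    have := enorm_tri xm y x0; move: st1 st2; rewrite !ltr_norml => h1 h2 h3.
    apply/OmP; split; [exact: ltW | by rewrite s0 ltW | by clear -yy h3; lra |].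
    by clear -h1 h2; lra.
  by have := fgle _ _ _ _ Omy; rewrite kapQ -fg; clear; lra.
move=> /(_ prem) /(gsupersol _ _ _ _ tmT).
pose zeta := arg xm tm + `|arg xm tm|.
have zeta0 : 0 <= zeta by rewrite /zeta; have := ler_norm (- arg xm tm); rewrite normrN; clear; lra.
have -> : Pv = (2 * kap * N) *: (zm - xm) - (2 * kap * M * zeta) *: (xm - x0).
  by apply/rowP => i; rewrite /Pv !mxE /kap /zeta /arg /G; ring.
have -> : tv = - (kap * (K * Qm + 2 * M * zeta * (G tm * (A * (G tm + D)))))
    + 2 * kap * E * (sm - tm).
  by rewrite /tv /kap /zeta QmE /arg /G; ring.
set pf := (2 * kap * N) *: (zm - xm) => supg.
have subf := fsubsol _ _ _ _ smT jetf.
have pfE : enorm pf = 2 * kap * N * enorm (xm - zm).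
  by rewrite /pf enormZ (enormBC xm) ger0_norm// (mulr_ge0 (mulr_ge0 (ler0n _ 2) kap0) (ltW N0)).
have hx := lipx xm zm sm pf smT'; have hp := lipp xm tm pf (pf - (2 * kap * M * zeta) *: (xm - x0)) tmT'.
(* kap <= 2 S / gam, because gam <= Q and kap Q <= 2 S. This momentum bound does not involve [E],
   which could therefore be chosen after the time modulus [dH]. *)
have pfb : enorm pf <= 2 * (2 * S / gam) * N * del.
  rewrite pfE; have : kap <= 2 * S / gam by rewrite ler_pdivlMr// (le_trans _ fg2S)// ler_pM2l ?(lt_trans ltr01)// QmE; clear -n0 p0 e0; lra.
  move=> kS; have := ler_pM kap0 (enorm_ge0 (xm - zm)) kS (ltW xz).
  by move/(ler_wpM2l (ltW N0)); clear; lra.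
have ht := uHP xm tm sm pf xr pfb tmT' smT'; rewrite distrC in ht.
apply: (@comparison_algebra _ lam C1 beta kap Qm N gam (enorm (xm - zm)) (2 * kap * E * (sm - tm))
  (2 * M * zeta * (G tm * (A * (G tm + D)))) `|H0 xm sm pf - H0 xm tm pf| (f zm sm) (g xm tm)
  (H0 zm sm pf) (H0 xm tm (pf - (2 * kap * M * zeta) *: (xm - x0)))) => //.
- exact: ltW.
- exact: enorm_ge0.
- by rewrite enorm_sqr QmE; clear -p0 e0; lra.
(* The momentum added by the cone penalty costs at most the propagation speed times its size; the
   shrinking of the radius at rate A (G + D) pays for it. *)
- have Ab : (A2 * enorm xm + B2) * enorm (xm - x0) <= A * (G tm + D) * G tm.
    apply: ler_pM; rewrite ?enorm_ge0 ?(ltW xG)//.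
      by rewrite addr_ge0// mulr_ge0 ?enorm_ge0.
    have := enormD (xm - x0) x0; rewrite subrK => tri.
    have : A2 * enorm xm <= A * enorm xm by rewrite ler_wpM2r ?enorm_ge0.
    have : A * enorm xm <= A * (G tm + enorm x0) by rewrite ler_pM2l//; clear -tri xG; lra.
    by clear -AD; lra.
  have kMz : 0 <= 2 * kap * M * zeta.
    by rewrite (mulr_ge0 (mulr_ge0 (mulr_ge0 (ler0n _ 2) kap0) (ltW M0)) zeta0).
  have eV V : pf - (pf - V) = V by rewrite opprB addrC subrK.
  move: hp; rewrite eV enormZ (ger0_norm kMz) => hp.
  have := ler_wpM2l kMz Ab; move: hx hp; rewrite pfE.
  have := ler_norm (H0 xm tm pf - H0 xm sm pf).
  rewrite distrC => h1 /ler_normlP[_ h2] /ler_normlP[h3 _] h4.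
  by clear -h1 h2 h3 h4; lra.
- exact: ht.
Qed.

(** * Local Lipschitz regularity of solutions in space *)

Lemma cont_st0_bounded {R : realType} {n : nat} (T : R) (f : 'rV[R]_n -> R -> R) x0 rho t' :
  cont_st0 T f -> t' < T ->
  exists S, forall z s, enorm (z - x0) <= rho -> 0 <= s <= t' -> `|f z s| <= S.
Proof.
move=> fc t'T; pose A := [set z | enorm (z - x0) <= rho] `*` `[0, t']%classic.
have cA : compact A by apply: compact_setX; [exact: compact_eball | exact: segment_compact].
have [A0|/forallNP A0] := pselect (A !=set0); last first.
  exists 0 => z s zr st; exfalso; apply: (A0 (z, s)); split => //=; by rewrite in_itv.
have [w Aw wmax] : exists2 w, A w & forall y, A y -> `|f y.1 y.2| <= `|f w.1 w.2|.
  apply: (compact_max_within cA A0 (f := fun w => `|f w.1 w.2|)) => -[x t] [/= _].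
  rewrite in_itv/= => tt; apply: cvg_norm.
  apply: (cont_st0_cvg _ fc); first by lra.
  - by apply: cvg_within_filter; exact: cvg_fst.
  - by apply: cvg_within_filter; exact: cvg_snd.
  - have inA : \forall y \near within A (nbhs (x, t)), A y by exact: withinT.
    by apply: filterS inA => -[y s] [/= _]; rewrite in_itv/=; lra.
exists `|f w.1 w.2| => z s zr st; apply: (wmax (z, s)).
by split => //=; rewrite in_itv.
Qed.

(** [u] is compared with itself, with N = 1 / d and gam = (L0^2 + 1) d for d = |z - y|. Initially L0
    a <= a^2 / d + L0^2 d / 4; at the later time N d^2 + gam is a multiple of d. *)
Lemma visc_sol_local_lip {R : realType} {n : nat} (T lam C1 beta A2 B2 L0 : R)
    (H0 : 'rV[R]_n -> R -> 'rV[R]_n -> R) (u0 : 'rV[R]_n -> R)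
    (u : 'rV[R]_n -> R -> R) (x : 'rV[R]_n) (t : R) :
  0 <= C1 -> 0 <= beta <= 1 -> 0 <= A2 -> 0 <= B2 -> cont_H T H0 ->
  (forall x y t p, 0 <= t <= T ->
    `|H0 x t p - H0 y t p| <= C1 * (beta + enorm p) * enorm (x - y)) ->
  (forall x t p q, 0 <= t <= T ->
    `|H0 x t p - H0 x t q| <= (A2 * enorm x + B2) * enorm (p - q)) ->
  (forall x y, `|u0 x - u0 y| <= L0 * enorm (x - y)) ->
  visc_sol T lam H0 u0 u ->
  0 < t < T -> exists2 L, 0 <= L & exists2 r, 0 < r &
  forall y z s, enorm (y - x) < r -> enorm (z - x) < r -> `|s - t| < r ->
    u z s - u y s <= L * enorm (z - y).
Proof.
move=> C10 beta01 A20 B20 contH lipx lipp lipu0 visc.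
move=> /andP[t0 tT]; have [uc [ui _]] := visc.
(* Adding 1 keeps the rate [A] positive when A2 = 0. *)
pose t' := (t + T) / 2; pose A := A2 + 1.
have tt' : t < t' by rewrite /t'; lra.
have t'T : t' < T by rewrite /t'; lra.
clearbody t'.
have A0 : 0 < A by rewrite /A; lra.
have BA0 : 0 <= B2 / A by rewrite divr_ge0 ?(ltW A0).
(* Contains the base of the cone for every centre [y] near [x] and every time up to [t'], so that
   the bound on |u| is independent of both. *)
pose rad := expR (A * t') + (enorm x + 1 + B2 / A) * expR (A * t').
have [S0 S0P] := @cont_st0_bounded _ _ T u x (rad + 2) t' uc t'T.
pose S := `|S0|; pose N0 := 2 * S + 1.
have N00 : 0 < N0 by rewrite /N0 /S; have := normr_ge0 S0; lra.
pose K := `|lam| + 3 * C1 + 1.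
have K0 : 0 < K by rewrite /K; have := normr_ge0 lam; lra.
have L1 : 0 < L0 ^+ 2 + 2 by rewrite ltr_wpDl ?sqr_ge0.
exists (expR (K * t') * (L0 ^+ 2 + 2)); first by rewrite mulr_ge0 ?expR_ge0// ltW.
(* The bound 1 / (2 N0) gives d N0 < 1, hence 2 S < 1 / d, the localization condition of
   [comparison] for N = 1 / d and margin 1. *)
pose r := Num.min (Num.min (1 / 2) (1 / (2 * N0))) (Num.min t (t' - t)).
exists r; first by rewrite !lt_min subr_gt0 tt' t0 !divr_gt0// mulr_gt0.
move=> y z s; rewrite !lt_min => /andP[/andP[y1 yN] _] /andP[/andP[z1 zN] _].
move=> /andP[_ /andP[st st']].
have s0 : 0 < s by move: st; rewrite ltr_norml; lra.
have ss' : s < t' by move: st'; rewrite ltr_norml; lra.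
have [->|zy] := eqVneq z y; first by rewrite !subrr enorm0 mulr0.
set d := enorm (z - y); have d0 : 0 < d.
  rewrite lt_def enorm_ge0 andbT; apply: contra zy => /eqP/enorm_eq0/eqP.
  by rewrite subr_eq0.
have dle : d <= enorm (z - x) + enorm (y - x).
  by have := enorm_tri x z y; rewrite (enormBC x).
have d1 : d <= 1 by lra.
have dN : d * N0 < 1.
  move: yN zN; rewrite !ltr_pdivlMr ?mulr_gt0// => yN zN.
  by have := ler_wpM2r (ltW N00) dle; lra.
have gam01 : L0 ^+ 2 / 4 * d < (L0 ^+ 2 + 1) * d.
  by rewrite ltr_pM2r//; have := sqr_ge0 L0; lra.
have Ngam : d^-1^-1 <= (L0 ^+ 2 + 1) * d.
  by rewrite invrK ler_peMl ?(ltW d0)// lerDr sqr_ge0.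
have expmono : expR (A * s) <= expR (A * t') by rewrite ler_expR ler_pM2l// ltW.
have es1 : 1 <= expR (A * s) by rewrite -expR0 ler_expR mulr_ge0// ltW.
have radP : 1 * expR (A * s) + (enorm y + B2 / A) * (expR (A * s) - 1) <= rad.
  rewrite mul1r /rad; apply: lerD => //.
  apply: ler_pM; first by rewrite addr_ge0 ?enorm_ge0.
  - by rewrite subr_ge0.
  - by have := enormD (y - x) x; rewrite subrK; clear -y1; lra.
  - by clear -expmono; lra.
have bnd w b : enorm (w - y) <= 1 * expR (A * s) + (enorm y + B2 / A) * (expR (A * s) - 1) + 1 ->
    0 <= b <= t' -> `|u w b| <= S /\ `|u w b| <= S.
  move=> wy bt; have : `|u w b| <= S0.
    apply: S0P => //; have := enorm_tri y w x; lra.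
  by have := ler_norm S0; rewrite -/S; split; lra.
have SN : 2 * S < d^-1 * 1 ^+ 2.
  rewrite expr1n mulr1 -[d^-1]mul1r ltr_pdivlMr//.
  by move: dN; rewrite /N0; nra.
have init a b : enorm (a - y) <= 1 * expR (A * s) + (enorm y + B2 / A) * (expR (A * s) - 1) ->
    enorm (b - y) <= 1 * expR (A * s) + (enorm y + B2 / A) * (expR (A * s) - 1) + 1 ->
    u b 0 - u a 0 <= d^-1 * vdot (b - a) (b - a) + L0 ^+ 2 / 4 * d.
  move=> _ _; rewrite !ui -enorm_sqr; have /ler_normlP[_ h] := lipu0 b a.
  apply: le_trans h _; rewrite -(ler_pM2l d0) mulrDr (mulrA d d^-1) mulfV ?gt_eqF// mul1r.
  by have := sqr_ge0 (enorm (b - a) - L0 / 2 * d); lra.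
have A2A : A2 <= A by rewrite /A; lra.
have di0 : 0 < d^-1 by rewrite invr_gt0.
have := comparison C10 beta01 A20 B20 contH lipx lipp uc uc
  (fun x t p tau tT => visc_sub visc tT) (fun x t p tau tT => visc_super visc tT)
  s0 ss' t'T A0 A2A ltr01 ltr01 di0 gam01 Ngam bnd SN init d1.
move/le_trans; apply; rewrite -enorm_sqr -/d -/K.
have -> : d^-1 * d ^+ 2 + (L0 ^+ 2 + 1) * d = (L0 ^+ 2 + 2) * d.
  by field; rewrite gt_eqF.
rewrite mulrA ler_wpM2r ?(ltW d0)// ler_wpM2r ?(ltW L1)//.
by rewrite ler_expR ler_pM2l// ltW.
Qed.

(** * Infima over moving balls *)

(** Parametrized by the unit ball, so that the compact set of competitors is fixed while the radius
    varies with time. *)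
Definition ballinf {R : realType} {n : nat} (u : 'rV[R]_n -> R -> R) (rho m : R -> R)
    (z : 'rV[R]_n) (t : R) : R :=
  inf [set u (z + rho t *: e) t | e in [set e : 'rV[R]_n | enorm e <= 1]] + m t.

Lemma ballinfP {R : realType} {n : nat} (T : R) (u : 'rV[R]_n -> R -> R) (rho m : R -> R)
    (z : 'rV[R]_n) (t : R) : cont_st0 T u -> 0 <= t < T -> exists e, [/\ enorm e <= 1,
  ballinf u rho m z t = u (z + rho t *: e) t + m t &
  forall e', enorm e' <= 1 -> ballinf u rho m z t <= u (z + rho t *: e') t + m t].
Proof.
move=> uc.
move=> tT; pose A : set 'rV[R]_n := [set e | enorm (e - 0) <= 1].
have A0 : A 0 by rewrite /A /= subrr enorm0.
have cA : compact A by exact: compact_eball.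
have fc e : A e -> - u (z + rho t *: y) t @[y --> within A (nbhs e)] --> - u (z + rho t *: e) t.
  move=> _; apply: cvgN; apply: (cont_st0_cvg _ uc tT).
  - by apply: cvgD; [exact: cvg_cst | apply: cvgZ; [exact: cvg_cst | exact: cvg_within]].
  - exact: cvg_cst.
  - by near=> y.
have [e Ae emin] := compact_max_within cA (ex_intro _ _ A0) fc.
have mine e' : enorm e' <= 1 -> u (z + rho t *: e) t <= u (z + rho t *: e') t.
  by move=> e'1; have := emin e'; rewrite /A /= subr0 lerN2; apply.
have e1 : enorm e <= 1 by move: Ae; rewrite /A /= subr0.
have infE : ballinf u rho m z t = u (z + rho t *: e) t + m t.
  congr (_ + _); apply/eqP; rewrite eq_le; apply/andP; split.
    apply: ge_inf; last by exists e.
    by exists (u (z + rho t *: e) t) => _ [e' e'1 <-]; exact: mine.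
  apply: lb_le_inf; first by exists (u (z + rho t *: e) t), e.
  by move=> _ [e' e'1 <-]; exact: mine.
exists e; split => // e' e'1; rewrite infE lerD2r; exact: mine.
Unshelve. all: by end_near. Qed.

Lemma ballinf_le {R : realType} {n : nat} (T : R) (u : 'rV[R]_n -> R -> R) (rho m : R -> R)
    (z y : 'rV[R]_n) (t : R) : cont_st0 T u -> 0 <= t < T -> 0 < rho t ->
  enorm (y - z) <= rho t -> ballinf u rho m z t <= u y t + m t.
Proof.
move=> uc tT r0 yz; have [e [_ _ +]] := ballinfP rho m z uc tT.
move=> /(_ ((rho t)^-1 *: (y - z))); rewrite scalerA mulfV ?gt_eqF// scale1r (addrC z) subrK.
by apply; rewrite enormZ gtr0_norm ?invr_gt0// ler_pdivrMl// mulr1.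
Qed.

(** By compactness of the unit ball the functions u (z + rho t e) t have a modulus common to all
    [e], which their infimum inherits. *)
Lemma ballinf_cont {R : realType} {n : nat} (T : R) (u : 'rV[R]_n -> R -> R) (rho m : R -> R)
    :
  cont_st0 T u ->
  (forall t eps, 0 < eps -> exists2 d, 0 < d & forall s, `|s - t| < d -> `|rho s - rho t| < eps) ->
  (forall t eps, 0 < eps -> exists2 d, 0 < d & forall s, `|s - t| < d -> `|m s - m t| < eps) ->
  cont_st0 T (ballinf u rho m).
Proof.
move=> uc rho_cont m_cont z t tT eps eps0.
have eps20 : 0 < eps / 2 by rewrite divr_gt0.
have eps40 : 0 < eps / 4 by rewrite divr_gt0.
pose P d (e : 'rV[R]_n) := forall z' t', 0 <= t' < T -> enorm (z' - z) < d -> `|t' - t| < d ->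
  `|u (z' + rho t' *: e) t' - u (z + rho t *: e) t| < eps / 2.
have [d d0 dP] : exists2 d, 0 < d & forall e, [set e | enorm (e - 0) <= 1] e -> P d e.
  apply: compact_uniform; first exact: compact_eball.
    move=> d d' e d'0 d'd Pd z' t' t'T zd td.
    by apply: Pd => //; exact: lt_le_trans d'd.
  move=> e0 _; have [d1 d10 ud] := uc (z + rho t *: e0) t tT _ eps40.
  have r1 : 0 < `|rho t| + 1 by rewrite ltr_wpDl.
  have d30 : 0 < d1 / 3 by rewrite divr_gt0.
  have [d2 d20 rd] := rho_cont t _ d30.
  exists (Num.min (Num.min (d1 / 3) d2) d1); first by rewrite !lt_min d10 d20 d30.
  apply: filterS (near_enorm e0 (divr_gt0 d30 r1)) => e; rewrite ltr_pdivlMr// => ee0.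
  rewrite /= subr0 => e1 z' t' t'T; rewrite !lt_min => /andP[/andP[zd _] _].
  move=> /andP[/andP[td td2] td1].
  have eb : enorm (rho t *: (e - e0)) <= d1 / 3.
    rewrite enormZ; apply: le_trans (ltW ee0); rewrite mulrC ler_wpM2l ?enorm_ge0//.
    by rewrite lerDl.
  have rb : enorm ((rho t' - rho t) *: e) <= d1 / 3.
    rewrite enormZ; have := rd t' td2; have := normr_ge0 (rho t' - rho t).
    move: (enorm_ge0 e) e1; clear; nra.
  have h1 : enorm (z' + rho t' *: e - (z + rho t *: e0)) < d1.
    have -> : z' + rho t' *: e - (z + rho t *: e0)
        = (z' - z) + (rho t' - rho t) *: e + rho t *: (e - e0).
      by apply/rowP => i; rewrite !mxE; ring.
    have := enormD (z' - z + (rho t' - rho t) *: e) (rho t *: (e - e0)).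
    by have := enormD (z' - z) ((rho t' - rho t) *: e); clear -zd rb eb; lra.
  have h2 : enorm (z + rho t *: e - (z + rho t *: e0)) < d1.
    have -> : z + rho t *: e - (z + rho t *: e0) = rho t *: (e - e0).
      by apply/rowP => i; rewrite !mxE; ring.
    by clear -eb d10; lra.
  have := ud _ _ t'T h1 td1; have := ud _ _ tT h2; rewrite subrr normr0 => /(_ d10).
  by clear; rewrite !ltr_norml; lra.
have [d3 d30 md] := m_cont t _ eps20.
exists (Num.min d d3); first by rewrite lt_min d0.
move=> z' t' t'T; rewrite !lt_min => /andP[zd _] /andP[td td3].
have [e [e1 wE _]] := ballinfP rho m z uc tT; have [e' [e1' wE' wle']] := ballinfP rho m z' uc t'T.
have [_ [_ _ wle]] := ballinfP rho m z uc tT.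
have A1 : [set e | enorm (e - 0) <= 1] e by rewrite /= subr0.
have A1' : [set e | enorm (e - 0) <= 1] e' by rewrite /= subr0.
have := dP e A1 z' t' t'T zd td; have := dP e' A1' z' t' t'T zd td.
have := md t' td3; have := wle e' e1'; have := wle' e e1; rewrite wE wE'.
by clear; rewrite !ltr_norml; lra.
Qed.

(** With [e] frozen, the ball infimum at (y - rho s e, s) is at most u y s + m s, with equality at
    the base point. The jet is carried along this moving translation, which subtracts dr q.e + dm
    from the time slope. *)
Lemma ballinf_subjet {R : realType} {n : nat} (T : R) (u : 'rV[R]_n -> R -> R) (rho m : R -> R)
    (z q e : 'rV[R]_n) (t sigma dr dm : R) :
  cont_st0 T u -> 0 < t < T -> 0 < rho t ->
  taylor2 (fun (_ : 'rV[R]_n) s => rho s) 0 t 0 dr ->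
  taylor2 (fun (_ : 'rV[R]_n) s => m s) 0 t 0 dm ->
  enorm e <= 1 -> ballinf u rho m z t = u (z + rho t *: e) t + m t ->
  prox_sub (ballinf u rho m) z t q sigma ->
  prox_sub u (z + rho t *: e) t q (sigma - dr * vdot q e - dm).
Proof.
move=> uc tT rt0 tr tm e1 wE [C [r r0 wC]].
have [M M0 [r1 r10 rl]] := taylor2_lip tr.
move: tr tm => [C2 [r2 r20 rt]] [C3 [r3 r30 mt]].
exists (`|C| * (2 + M) ^+ 2 + `|C2| * `|vdot q e| + `|C3|).
have M1 : 0 < M + 1 by rewrite ltr_wpDl.
exists (Num.min (Num.min (Num.min (r / (2 * (M + 1))) r1) (Num.min r2 r3)) (Num.min t (T - t))).
  by rewrite !lt_min r10 r20 r30 subr_gt0 tT !andbT divr_gt0// mulr_gt0.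
move=> y s; rewrite !lt_min => /andP[/andP[/andP[yr _] _] _].
move=> /andP[/andP[/andP[sr s1] /andP[s2 s3]] /andP[st sT]].
have sT' : 0 <= s < T by move: st sT; clear; rewrite !ltr_norml; lra.
have := rl 0 s; rewrite subrr enorm0 add0r => /(_ r10 s1) rl'.
have := rt 0 s; rewrite subrr enorm0 vdot0r subr0 add0r => /(_ r20 s2) rt'.
have := mt 0 s; rewrite subrr enorm0 vdot0r subr0 add0r => /(_ r30 s3) mt'.
clear rl rt mt.
pose z' := y - rho s *: e.
have zE : z' - z = (y - (z + rho t *: e)) - (rho s - rho t) *: e.
  by apply/rowP => i; rewrite !mxE; ring.
have wz : ballinf u rho m z' s <= u y s + m s.
  by have [_ [_ _ /(_ e e1)]] := ballinfP rho m z' uc sT'; rewrite /z' subrK.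
set a := enorm (y - (z + rho t *: e)) in yr *.
have a0 : 0 <= a by exact: enorm_ge0.
have b0 : 0 <= `|s - t| by [].
have zb : enorm (z' - z) <= a + M * `|s - t|.
  rewrite zE; apply: le_trans (enormB _ _) _; rewrite lerD2l enormZ.
  by apply: le_trans rl'; rewrite ler_piMr.
move: yr sr; rewrite !ltr_pdivlMr ?mulr_gt0// => yr sr.
have zr : enorm (z' - z) < r.
  apply: le_lt_trans zb _.
  have := mulr_ge0 M0 a0; have := mulr_ge0 M0 b0; clear -yr sr a0 b0; lra.
have sr' : `|s - t| < r.
  have := mulr_ge0 M0 b0; clear -sr b0; lra.
have := wC z' s zr sr'; rewrite wE zE vdotDr vdotNr vdotZr => w1.
have Cb : C * (enorm (y - (z + rho t *: e) - (rho s - rho t) *: e) + `|s - t|) ^+ 2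
    <= `|C| * (2 + M) ^+ 2 * (a + `|s - t|) ^+ 2.
  rewrite -zE; apply: (@le_trans _ _ (`|C| * (enorm (z' - z) + `|s - t|) ^+ 2)).
    by rewrite ler_wpM2r ?sqr_ge0// ler_norm.
  have nn : 0 <= (2 + M) * (a + `|s - t|) by rewrite mulr_ge0// addr_ge0.
  rewrite -mulrA -exprMn ler_wpM2l//.
  apply: lerXn2r; rewrite ?nnegrE// ?addr_ge0 ?enorm_ge0//.
  by have := mulr_ge0 M0 a0; clear -zb a0 b0; lra.
have sb : `|s - t| ^+ 2 <= (a + `|s - t|) ^+ 2.
  by rewrite ler_pXn2r ?nnegrE ?addr_ge0// lerDr.
have cb c : c * `|s - t| ^+ 2 <= `|c| * (a + `|s - t|) ^+ 2.
  apply: (@le_trans _ _ (`|c| * `|s - t| ^+ 2)); first by rewrite ler_wpM2r ?sqr_ge0// ler_norm.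
  by rewrite ler_wpM2l.
have C20 := le_trans rt' (cb C2); have C30 := le_trans mt' (cb C3).
have rq : `|(rho s - rho t - dr * (s - t)) * vdot q e|
    <= `|C2| * (a + `|s - t|) ^+ 2 * `|vdot q e| by rewrite normrM ler_wpM2r.
move: rq C30 w1 wz Cb; clear.
move: (enorm _ + _) => B; rewrite !ler_norml => /andP[? ?] /andP[? ?] ? ? ?.
lra.
Qed.

Lemma taylor2_cont {R : realType} {n : nat} (r : R -> R) (t dr : R) :
  taylor2 (fun (_ : 'rV[R]_n) s => r s) 0 t 0 dr ->
  forall eps, 0 < eps -> exists2 d, 0 < d & forall s, `|s - t| < d -> `|r s - r t| < eps.
Proof.
move=> /taylor2_lip[M M0 [d d0 lip]] eps eps0.
have M1 : 0 < M + 1 by rewrite ltr_wpDl.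
exists (Num.min d (eps / (M + 1))); first by rewrite lt_min d0 divr_gt0.
move=> s; rewrite lt_min ltr_pdivlMr// => /andP[sd se].
have := lip 0 s; rewrite subrr enorm0 add0r => /(_ d0 sd) /le_lt_trans; apply.
by apply: le_lt_trans se; rewrite mulrC ler_wpM2l// lerDl.
Qed.

Lemma cont_st0_st_cont {R : realType} {n : nat} (T : R) (f : 'rV[R]_n -> R -> R) x t :
  cont_st0 T f -> 0 < t < T -> st_cont f x t.
Proof.
move=> fc /andP[t0 tT] e e0.
have [|d d0 fd] := fc x t _ e e0; first by rewrite tT ltW.
exists (Num.min d (Num.min t (T - t))); first by rewrite !lt_min d0 t0 subr_gt0.
move=> y s; rewrite !lt_min => /andP[yd _] /andP[sd /andP[st sT]].
by apply: fd => //; move: st sT; clear; rewrite !ltr_norml; lra.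
Qed.

(** Moving the centre by h rho (e + q / |q|), with h <= 1, keeps the minimizing point in the ball,
    so the infimum does not rise in that direction and q.(e + q / |q|) <= 0. *)
Lemma ballinf_grad {R : realType} {n : nat} (T : R) (u : 'rV[R]_n -> R -> R)
    (rho m : R -> R) (z q e : 'rV[R]_n) (t sigma : R) :
  cont_st0 T u -> 0 < t < T -> 0 < rho t -> enorm e <= 1 ->
  ballinf u rho m z t = u (z + rho t *: e) t + m t ->
  prox_sub (ballinf u rho m) z t q sigma -> vdot q e <= - enorm q.
Proof.
move=> uc tT rt0 e1 wE /prox_sub_fsub fs.
have tT' : 0 <= t < T by move: tT; clear; lra.
have [->|q0] := eqVneq q 0; first by rewrite vdot0l enorm0 oppr0.
have Q : 0 < enorm q.
  by rewrite lt_def enorm_ge0 andbT; apply: contra q0 => /eqP/enorm_eq0 ->.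
pose qh := (enorm q)^-1 *: q.
have qh1 : enorm qh = 1 by rewrite enormZ gtr0_norm ?invr_gt0// mulVf// gt_eqF.
have qqh : vdot q qh = enorm q by rewrite vdotZr -enorm_sqr expr2 mulrA mulVf ?mul1r// gt_eqF.
pose d := rho t *: (e + qh).
suff : vdot q d <= 0 by rewrite vdotZr pmulr_rle0// vdotDr qqh; clear; lra.
apply/ler_addgt0Pr => eps eps0; rewrite add0r.
have D1 : 0 < enorm d + 1 by rewrite ltr_wpDl ?enorm_ge0.
have [d1 d10 fd] := fs _ (divr_gt0 eps0 D1).
pose h := Num.min 1 (d1 / (2 * (enorm d + 1))).
have h0 : 0 < h by rewrite lt_min ltr01 divr_gt0// mulr_gt0.
have h1 : h <= 1 by rewrite ge_min lexx.
have hd : h * enorm d < d1.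
  have : h <= d1 / (2 * (enorm d + 1)) by rewrite ge_min lexx orbT.
  rewrite ler_pdivlMr ?mulr_gt0//; have := mulr_ge0 (ltW h0) (enorm_ge0 d).
  by clear -h0; lra.
have := fd (z + h *: d) t.
rewrite (addrC z) addrK enormZ gtr0_norm// subrr normr0 mulr0 !addr0 => /(_ hd d10).
have wle : ballinf u rho m (h *: d + z) t <= u (z + rho t *: e) t + m t.
  apply: (ballinf_le m uc tT' rt0).
  have -> : z + rho t *: e - (h *: d + z) = rho t *: ((1 - h) *: e - h *: qh).
    by apply/rowP => i; rewrite /d !mxE; ring.
  rewrite enormZ gtr0_norm// -[leRHS]mulr1 ler_pM2l//.
  apply: le_trans (enormB _ _) _; rewrite (enormZ (1 - h)) (enormZ h) qh1 (gtr0_norm h0) mulr1.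
  rewrite ger0_norm ?subr_ge0//.
  have : (1 - h) * enorm e <= (1 - h) * 1 by rewrite ler_wpM2l// subr_ge0.
  by clear; lra.
rewrite wE => /le_trans/(_ wle); rewrite vdotZr => hq.
have {hq} : h * vdot q d <= h * (eps / (enorm d + 1) * enorm d) by move: hq; clear; lra.
rewrite ler_pM2l// => /le_trans; apply.
by rewrite mulrAC ler_pdivrMr// ler_wpM2l ?(ltW eps0)// lerDl.
Qed.

Definition hamiltonian_hyp {R : realType} {n : nat} (T C1 beta A2 B2 : R)
    (H0 : 'rV[R]_n -> R -> 'rV[R]_n -> R) : Prop :=
  [/\ 0 <= C1 /\ 0 <= beta <= 1, 0 <= A2 /\ 0 <= B2, cont_H T H0,
    (forall x y t p, 0 <= t <= T ->
      `|H0 x t p - H0 y t p| <= C1 * (beta + enorm p) * enorm (x - y)) &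
    (forall x t p q, 0 <= t <= T ->
      `|H0 x t p - H0 x t q| <= (A2 * enorm x + B2) * enorm (p - q)) /\
    (forall x t p q (th : R), 0 <= t <= T -> 0 <= th <= 1 ->
      H0 x t (th *: p + (1 - th) *: q) <= th * H0 x t p + (1 - th) * H0 x t q)].

(** A single [d] is both the radius and the inverse of the Lipschitz constant, which makes the
    property monotone in [d], as [compact_uniform] requires. *)
Lemma visc_sol_uniform_lip {R : realType} {n : nat} (T lam C1 beta A2 B2 L0 : R)
    (H0 : 'rV[R]_n -> R -> 'rV[R]_n -> R) u0 u (x : 'rV[R]_n) (t rho : R) :
  hamiltonian_hyp T C1 beta A2 B2 H0 ->
  (forall x y, `|u0 x - u0 y| <= L0 * enorm (x - y)) -> visc_sol T lam H0 u0 u ->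
  0 < t < T -> exists2 d, 0 < d & forall y, enorm (y - x) <= rho ->
    forall z s, enorm (z - y) < d -> `|s - t| < d ->
    `|u z s - u y s| <= d^-1 * enorm (z - y).
Proof.
move=> [[C10 beta01] [A20 B20] contH lipx [lipp _]] lipu0 visc tT.
apply: (@compact_uniform _ _ [set y | enorm (y - x) <= rho] (@compact_eball _ _ x rho)
  (fun d y => forall z s, enorm (z - y) < d -> `|s - t| < d ->
    `|u z s - u y s| <= d^-1 * enorm (z - y))).
  move=> d d' y d'0 d'd Pd z s zy st.
  apply: (le_trans (Pd z s (lt_le_trans zy d'd) (lt_le_trans st d'd))).
  by rewrite ler_wpM2r ?enorm_ge0// lef_pV2// posrE// (lt_le_trans d'0).
move=> y _; have [L L0' [r r0 lip]] :=
  visc_sol_local_lip y C10 beta01 A20 B20 contH lipx lipp lipu0 visc tT.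
have L1 : 0 < L + 1 by rewrite ltr_wpDl.
exists (Num.min (r / 2) (L + 1)^-1); first by rewrite lt_min divr_gt0 ?invr_gt0.
have r20 : 0 < r / 2 by rewrite divr_gt0.
apply: filterS (near_enorm y r20) => y' y'y _ z s.
rewrite !lt_min => /andP[zy' _] /andP[st _].
have zr : enorm (z - y) < r by have := enorm_tri y' z y; move: zy' y'y; clear; lra.
have y'r : enorm (y' - y) < r by move: r0 y'y; clear; lra.
have sr : `|s - t| < r by move: st r0; clear; lra.
apply: (@le_trans _ _ (L * enorm (z - y'))).
  have := lip _ _ s y'r zr sr; have := lip _ _ s zr y'r sr.
  by rewrite (enormBC y' z) ler_norml; clear; lra.
rewrite ler_wpM2r ?enorm_ge0//; apply: (@le_trans _ _ (L + 1)); first by rewrite lerDl.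
rewrite -[leLHS]invrK lef_pV2 ?posrE ?lt_min ?r20 ?invr_gt0//.
by rewrite ge_min lexx orbT.
Qed.

(** At the minimizing point the transported slope contains - C1 rho q.e >= C1 rho |q| and C1 beta
    rho. Together they pay for C1 (beta + |q|) rho, the cost of moving the Hamiltonian back to the
    centre, while lam u + lam m combine into lam times the infimum. *)
Lemma ballinf_subsol {R : realType} {n : nat} (T lam C1 beta A2 B2 L0 : R)
    (H0 : 'rV[R]_n -> R -> 'rV[R]_n -> R) u0 u (rho m : R -> R) :
  hamiltonian_hyp T C1 beta A2 B2 H0 ->
  (forall x y, `|u0 x - u0 y| <= L0 * enorm (x - y)) -> visc_sol T lam H0 u0 u ->
  (forall t, 0 < rho t) ->
  (forall t, taylor2 (fun (_ : 'rV[R]_n) s => rho s) 0 t 0 (C1 * rho t)) ->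
  (forall t, taylor2 (fun (_ : 'rV[R]_n) s => m s) 0 t 0 (- lam * m t - C1 * beta * rho t)) ->
  forall x t p tau, 0 < t < T -> prox_sup (ballinf u rho m) x t p tau ->
    tau + lam * ballinf u rho m x t + H0 x t p <= 0.
Proof.
move=> hH lipu0 visc rho0 rhoT mT x t p tau tT jet.
(* The margin 2 is made of 1 for the variation of [rho] near [t], 1/2 for the centre [y] and 1/2 for
   the points around the minimizer. *)
have [d d0 lip] := visc_sol_uniform_lip x (rho t + 2) hH lipu0 visc tT.
move: hH => [[C10 beta01] [A20 B20] contH lipx [lipp conv]].
have [uc _] := visc.
have rc s := taylor2_cont (rhoT s); have mc s := taylor2_cont (mT s).
have wc : cont_st0 T (ballinf u rho m) by apply: ballinf_cont.
have [dr dr0 rd] := rc t _ (ltr01 : 0 < (1 : R)).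
pose M := Num.min (Num.min (1 / 2) dr) (Num.min d (Num.min t (T - t))).
have M0 : 0 < M by rewrite !lt_min dr0 d0 subr_gt0 divr_gt0.
have : M <= M by [].
rewrite {2}/M !le_min => /andP[/andP[M1 Mdr] /andP[Md /andP[Mt MT]]].
pose r := M / 2.
have rM : r < M by move: M0; rewrite /r; clear; lra.
have r0 : 0 < r by rewrite divr_gt0.
have r1 := lt_le_trans rM M1; have rdr := lt_le_trans rM Mdr.
have rdd := lt_le_trans rM Md.
have rT s : `|s - t| <= r -> 0 < s < T.
  by move: rM Mt MT; clear; rewrite ler_norml; lra.
have dV0 : 0 <= d^-1 by rewrite invr_ge0 ltW.
have fs : fsup (ballinf u rho m) x t p tau.
  move: (prox_sub_fsub (prox_sup_subN jet)) => h eps /h[d' d'0 hd'].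
  by exists d' => // y s yx st; have := hd' y s yx st; rewrite vdotNl mulNr; clear; lra.
apply: (barron_jensen_sup (lam := lam) A20 B20 contH lipp conv tT r0 _ _ fs (L := d^-1)).
  by move=> y s _ /rT sT; exact: cont_st0_st_cont sT.
move=> y s q sigma yx st jetw.
have sT := rT s (ltW st).
have sT' : 0 <= s < T by move: sT; clear; lra.
have [e [e1 wE _]] := ballinfP rho m y uc sT'.
have qe := ballinf_grad uc sT (rho0 s) e1 wE jetw.
have jetu := ballinf_subjet uc sT (rho0 s) (rhoT s) (mT s) e1 wE jetw.
set ys := y + rho s *: e in wE jetu.
have ysy : enorm (ys - y) <= rho s.
  by rewrite /ys (addrC y) addrK enormZ (gtr0_norm (rho0 s)) ler_piMr// ltW.
have ysx : enorm (ys - x) <= rho t + 3 / 2.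
  have := rd s (lt_trans st rdr); have := enorm_tri y ys x.
  by move: ysy yx r1; clear; rewrite ltr_norml; lra.
have ysx2 : enorm (ys - x) <= rho t + 2 by move: ysx; clear; lra.
have std : `|s - t| < d by exact: lt_trans rdd.
have qL : enorm q <= d^-1.
  apply: (fsub_enorm_le d0 dV0 _ (prox_sub_fsub jetu)) => z zy.
  by have := lip ys ysx2 z s zy std; apply: le_trans; exact: ler_norm.
split => //.
have r20 : 0 < Num.min (1 / 2) (r - `|s - t|) by rewrite lt_min subr_gt0 st andbT; clear; lra.
have rT' s' : `|s' - s| <= Num.min (1 / 2) (r - `|s - t|) -> `|s' - t| <= r.
  rewrite le_min => /andP[_]; have := ler_distD s s' t.
  by clear; lra.
have ucn y' s' : enorm (y' - ys) <= Num.min (1 / 2) (r - `|s - t|) ->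
    `|s' - s| <= Num.min (1 / 2) (r - `|s - t|) -> st_cont u y' s'.
  by move=> _ /rT'/rT; exact: cont_st0_st_cont.
have ujets y' s' q' sigma' : enorm (y' - ys) < Num.min (1 / 2) (r - `|s - t|) ->
    `|s' - s| < Num.min (1 / 2) (r - `|s - t|) -> prox_sup u y' s' q' sigma' ->
    enorm q' <= d^-1 /\ sigma' + lam * u y' s' + H0 y' s' q' <= 0.
  move=> yys0 /ltW/rT' s't jet'; split; last exact: visc_sub visc (rT _ s't) jet'.
  have yys : enorm (y' - ys) < 1 / 2 by apply: (lt_le_trans yys0); rewrite ge_min lexx.
  apply: (prox_sup_enorm_le d0 dV0 _ jet') => z zy'.
  have y'x : enorm (y' - x) <= rho t + 2.
    by have := enorm_tri ys y' x; move: yys ysx; clear; lra.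
  have s'd : `|s' - t| < d by exact: le_lt_trans rdd.
  by have := lip y' y'x z s' zy' s'd; apply: le_trans; rewrite distrC ler_norm.
have := barron_jensen_sub (lam := lam) A20 B20 contH lipp conv sT r20 ucn ujets
  (prox_sub_fsub jetu).
have sT2 : 0 <= s <= T by move: sT; clear; lra.
have /ler_normlP[_] := lipx y ys s q sT2; rewrite wE.
have : C1 * (beta + enorm q) * enorm (y - ys) <= C1 * (beta + enorm q) * rho s.
  rewrite ler_wpM2l ?mulr_ge0 ?addr_ge0 ?enorm_ge0//; first by case/andP: beta01.
  by rewrite enormBC.
have : C1 * rho s * vdot q e <= C1 * rho s * (- enorm q).
  by rewrite ler_wpM2l// mulr_ge0// ltW.
by clear; lra.
Qed.

(** * Decay of the initial datum *)

Section SmoothNorm.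
Context {R : realType} {n : nat}.
Implicit Types (x y a p q : 'rV[R]_n) (k th : R).

(** A smooth norm lying strictly above |y|, equal to k at 0, whose gradient has length strictly less
    than 1 everywhere. *)
Definition snorm k y : R := Num.sqrt (vdot y y + k ^+ 2).

Lemma snorm_sqr k y : snorm k y ^+ 2 = vdot y y + k ^+ 2.
Proof. by rewrite sqr_sqrtr// addr_ge0 ?vdot_ge0 ?sqr_ge0. Qed.

Lemma snorm_gt0 k y : 0 < k -> 0 < snorm k y.
Proof. by move=> k0; rewrite sqrtr_gt0 ltr_wpDl ?vdot_ge0 ?exprn_gt0. Qed.

Lemma snorm_ge k y : 0 < k -> k <= snorm k y.
Proof.
move=> k0; rewrite -(@ler_pXn2r _ 2)// ?nnegrE ?(ltW k0) ?(ltW (snorm_gt0 y k0))//.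
by rewrite snorm_sqr lerDr vdot_ge0.
Qed.

Lemma enorm_lt_snorm k y : 0 < k -> enorm y < snorm k y.
Proof.
move=> k0; rewrite -(@ltr_pXn2r _ 2)// ?nnegrE ?enorm_ge0 ?(ltW (snorm_gt0 y k0))//.
by rewrite snorm_sqr enorm_sqr ltrDl exprn_gt0.
Qed.

Lemma snorm0 k : 0 < k -> snorm k 0 = k.
Proof. by move=> k0; rewrite /snorm vdot0l add0r sqrtr_sqr gtr0_norm. Qed.

Lemma snorm_taylor k x y : 0 < k ->
  `|snorm k y - snorm k x - vdot ((snorm k x)^-1 *: x) (y - x)|
    <= k^-1 * enorm (y - x) ^+ 2.
Proof.
move=> k0; have a0 := snorm_gt0 x k0; have b0 := snorm_gt0 y k0.
have ak := snorm_ge x k0.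
have ea := snorm_sqr k x; have eb := snorm_sqr k y.
rewrite vdotZl vdotDr vdotNr enorm_sqr !vdotE (vdotC y x).
move: (snorm k x) (snorm k y) a0 b0 ak ea eb => a b a0 b0 ak ea eb.
(* Cauchy-Schwarz for (x, k) and (y, k) in dimension n + 1. *)
have cs : vdot x y + k ^+ 2 <= a * b.
  have [h|h] := ltP (vdot x y + k ^+ 2) 0; first by rewrite (le_trans (ltW h))// mulr_ge0 ?ltW.
  rewrite -(@ler_pXn2r _ 2)// ?nnegrE ?mulr_ge0 ?(ltW a0) ?(ltW b0)//.
  rewrite exprMn ea eb -!enorm_sqr.
  have := vdot_abs x y; have := enorm_ge0 x; have := enorm_ge0 y.
  move: (enorm x) (enorm y) (vdot x y) => P Q v Q0 P0 vPQ.
  have h1 : v ^+ 2 <= P ^+ 2 * Q ^+ 2.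
    by rewrite -exprMn -(real_normK (num_real v)); apply: lerXn2r; rewrite ?nnegrE ?mulr_ge0.
  have h2 : 2 * v <= P ^+ 2 + Q ^+ 2.
    have := sqr_ge0 (P - Q); have := ler_norm v; lra.
  have := ler_wpM2r (sqr_ge0 k) h2; lra.
rewrite [leRHS](_ : _ = k^-1 * (b ^+ 2 + a ^+ 2 - 2 * (vdot x y + k ^+ 2))); last first.
  by rewrite ea eb; ring.
have -> : a^-1 * (vdot x y - vdot x x) = a^-1 * (vdot x y + k ^+ 2) - a.
  have -> : vdot x x = a ^+ 2 - k ^+ 2 by rewrite ea addrK.
  by field; rewrite gt_eqF.
move: (vdot x y + k ^+ 2) cs => c cs.
have -> : b - a - (a^-1 * c - a) = a^-1 * (a * b - c) by field; rewrite gt_eqF.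
rewrite ger0_norm; last by rewrite mulr_ge0 ?subr_ge0// invr_ge0 ltW.
have ki : a^-1 <= k^-1 by rewrite lef_pV2.
have h0 : 0 <= a * b - c by rewrite subr_ge0.
apply: (@le_trans _ _ (k^-1 * (a * b - c))); first by rewrite ler_wpM2r.
rewrite ler_pM2l ?invr_gt0//; have := sqr_ge0 (a - b); lra.
Qed.

Lemma snorm_grad_lip k x y : 0 < k ->
  enorm ((snorm k y)^-1 *: y - (snorm k x)^-1 *: x) <= 2 / k * enorm (y - x).
Proof.
move=> k0; have a0 := snorm_gt0 x k0; have b0 := snorm_gt0 y k0.
have ak := snorm_ge x k0; have yb := enorm_lt_snorm y k0; have xa := enorm_lt_snorm x k0.
set a := snorm k x in a0 ak xa *; set b := snorm k y in b0 yb *.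
have ab : `|b - a| <= enorm (y - x).
  have e : (b - a) * (b + a) = vdot (y - x) (y + x).
    rewrite -subr_sqr !snorm_sqr !vdotE (vdotC x y); ring.
  have : `|b - a| * (b + a) <= enorm (y - x) * (b + a).
    have s0 : 0 <= b + a by rewrite ltW// addr_gt0.
    rewrite -{1}(ger0_norm s0) -normrM e.
    apply: le_trans (vdot_abs _ _) _; rewrite ler_wpM2l ?enorm_ge0//.
    by apply: le_trans (enormD _ _) _; rewrite lerD// ltW.
  by rewrite ler_pM2r// addr_gt0.
have -> : b^-1 *: y - a^-1 *: x = a^-1 *: (y - x) + ((a - b) / a) *: (b^-1 *: y).
  apply/rowP => i; rewrite !mxE; field.
  by rewrite !gt_eqF.
apply: le_trans (enormD _ _) _; rewrite !enormZ (gtr0_norm (_ : 0 < a^-1)) ?invr_gt0//.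
have yb1 : `|b^-1| * enorm y <= 1.
  by rewrite gtr0_norm ?invr_gt0// ler_pdivrMl// mulr1 ltW.
have d1 : `|(a - b) / a| <= enorm (y - x) / a.
  by rewrite normrM (gtr0_norm (_ : 0 < a^-1)) ?invr_gt0// distrC ler_wpM2r// invr_ge0 ltW.
have ki : a^-1 <= k^-1 by rewrite lef_pV2.
have h1 : `|(a - b) / a| * (`|b^-1| * enorm y) <= enorm (y - x) / a.
  by apply: le_trans d1; rewrite ler_piMr.
have := ler_wpM2l (enorm_ge0 (y - x)) ki; lra.
Qed.

Lemma C1_snorm k a th : 0 < k -> 0 < th ->
  C1_grad (fun y => - th * snorm k (y - a))
          (fun y => - th *: ((snorm k (y - a))^-1 *: (y - a))).
Proof.
move=> k0 th0 x.
have yx y : y - x = (y - a) - (x - a) by rewrite opprB addrA subrK.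
have c0 : 0 < th * (2 / k) by rewrite mulr_gt0// divr_gt0.
split=> e e0; exists (e / (th * (2 / k))); rewrite ?divr_gt0// => y; rewrite ltr_pdivlMr// => yd.
  rewrite -scalerBr enormZ normrN (gtr0_norm th0); apply: le_lt_trans yd.
  have := snorm_grad_lip (x - a) (y - a) k0; rewrite -yx => h.
  by apply: le_trans (ler_wpM2l (ltW th0) h) _; rewrite [leRHS]mulrC -[leRHS]mulrA.
have := snorm_taylor (x - a) (y - a) k0; rewrite -yx.
rewrite [X in `|X| <= e * _](_ : _ = - th * (snorm k (y - a) - snorm k (x - a)
   - vdot ((snorm k (x - a))^-1 *: (x - a)) (y - x))); last by rewrite !vdotZl; ring.
rewrite normrM normrN (gtr0_norm th0) => h.
apply: (@le_trans _ _ (th * (k^-1 * enorm (y - x) ^+ 2))); first by rewrite ler_pM2l.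
rewrite expr2 !mulrA ler_wpM2r ?enorm_ge0//; apply: le_trans (ltW yd).
rewrite [leRHS]mulrC ler_wpM2r ?enorm_ge0// ler_pM2l// ler_peMl ?invr_ge0 ?(ltW k0)//.
by rewrite ler1n.
Qed.

End SmoothNorm.

(* If all subgradients near x have norm >= th, minimizing u0 + th*snorm k (. - x) over the
   ball cannot produce an interior minimum, so u0 decreases at rate th. *)
Lemma initial_decay {R : realType} {n : nat} (u0 : 'rV[R]_n -> R) (L th rho : R) x :
  (forall x y, `|u0 x - u0 y| <= L * enorm (x - y)) -> 0 < th -> 0 < rho ->
  (forall y q, enorm (y - x) <= rho -> subdiff u0 y q -> th <= enorm q) ->
  exists2 y, enorm (y - x) <= rho & u0 y + th * rho <= u0 x.
Proof.
move=> lip th0 rho0 big; apply: contrapT => /forall2NP no.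
have gt y : enorm (y - x) <= rho -> u0 x < u0 y + th * rho.
  by move=> yr; rewrite ltNge; apply/negP => le; have [] := no y.
pose A : set 'rV[R]_n := [set y | enorm (y - x) <= rho].
have Ax : A x by rewrite /A /= subrr enorm0 ltW.
have cA : compact A by exact: compact_eball.
have u0c y : u0 z @[z --> within A (nbhs y)] --> u0 y.
  apply: cvg_within_filter; apply/cvgrPdist_lt => e e0.
  have l1 : 0 < `|L| + 1 by rewrite ltr_wpDl.
  apply: filterS (near_enorm y (divr_gt0 e0 l1)) => z; rewrite ltr_pdivlMr// => yz.
  apply: le_lt_trans (lip _ _) _; rewrite enormBC; apply: le_lt_trans yz.
  by rewrite mulrC ler_wpM2l ?enorm_ge0// ler_wpDr// ler_norm.
have [y0 Ay0 miny0] := compact_max_within cA (ex_intro _ _ Ax)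
  (fun y _ => cvgN (u0c y)).
pose eta := u0 y0 + th * rho - u0 x.
have eta0 : 0 < eta by rewrite subr_gt0 gt.
(* The penalized value at the centre is then u0 x + eta / 2, below every boundary value, which is at
   least u0 x + eta. *)
pose k := eta / (2 * th).
have k0 : 0 < k by rewrite divr_gt0// mulr_gt0.
have kth : th * k = eta / 2 by rewrite /k; field; rewrite gt_eqF.
pose F y := - u0 y - th * snorm k (y - x).
have Fc y : A y -> F z @[z --> within A (nbhs y)] --> F y.
  move=> _; apply: cvgB; first exact: (cvgN (u0c y)).
  apply: cvgM; first exact: cvg_cst.
  have c1 : z - x @[z --> within A (nbhs y)] --> y - x.
    by apply: cvgB; [exact: cvg_within | exact: cvg_cst].
  have c2 : vdot (z - x) (z - x) + k ^+ 2 @[z --> within A (nbhs y)]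
      --> vdot (y - x) (y - x) + k ^+ 2.
    by apply: cvgD; [exact: (cvg_vdot c1 c1) | exact: cvg_cst].
  have c3 : Num.sqrt v @[v --> vdot (y - x) (y - x) + k ^+ 2]
      --> Num.sqrt (vdot (y - x) (y - x) + k ^+ 2) by exact: sqrt_continuous.
  exact: (cvg_comp _ _ c2 c3).
have [y1 Ay1 miny1] := compact_max_within cA (ex_intro _ _ Ax) Fc.
have y1r : enorm (y1 - x) < rho.
  rewrite lt_neqAle Ay1 andbT; apply/eqP => e.
  have := miny1 x Ax; rewrite /F subrr snorm0// kth.
  have := miny0 y1 Ay1; have := ltW (enorm_lt_snorm (y1 - x) k0); rewrite e => h.
  by have := ler_wpM2l (ltW th0) h; move: eta0; rewrite /eta; clear; lra.
have : subdiff u0 y1 (- th *: ((snorm k (y1 - x))^-1 *: (y1 - x))).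
  exists (fun y => - th * snorm k (y - x)),
    (fun y => - th *: ((snorm k (y - x))^-1 *: (y - x))); split; first exact: C1_snorm.
  split => //; exists (rho - enorm (y1 - x)); first by rewrite subr_gt0.
  move=> y yy1; have Ay : A y.
    by have := enorm_tri y1 y x; move: yy1; rewrite /A /=; clear; lra.
  by have := miny1 y Ay; rewrite /F; clear; lra.
(* The subgradient at the interior minimum has norm th |y1 - x| / snorm k (y1 - x) < th. *)
move=> /(big _ _ (ltW y1r)).
rewrite !enormZ normrN (gtr0_norm th0) gtr0_norm ?invr_gt0 ?snorm_gt0//.
rewrite -[leLHS]mulr1 ler_pM2l// ler_pdivlMl ?snorm_gt0// mulr1.
by rewrite leNgt enorm_lt_snorm.
Qed.

(** The base radius of the cone in [comparison] can be brought down to [Rad]: with A = A2 and small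
    th if A2 > 0, and with A and th both small if A2 = 0, since B2 t is the limit of (B2 / A) (exp
    (A t) - 1). *)
Lemma Rad_approx {R : realType} {n : nat} (A2 B2 t eta : R) (x : 'rV[R]_n) :
  0 <= A2 -> 0 <= B2 -> 0 < t -> 0 < eta -> exists A, exists th,
  [/\ 0 < A, A2 <= A, 0 < th &
   th * expR (A * t) + (enorm x + B2 / A) * (expR (A * t) - 1) <= Rad A2 B2 x t + eta].
Proof.
move=> A20 B20 t0 eta0; rewrite /Rad; case: ltP => A2p.
  exists A2, (eta / expR (A2 * t)); split => //; first by rewrite divr_gt0 ?expR_gt0.
  by rewrite divfK ?gt_eqF ?expR_gt0// addrC (addrC (enorm x)).
have N0 := enorm_ge0 x.
(* A W <= eta makes the terms of order A left by the expansion of the exponential at most eta /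
   4. *)
pose W := 4 * (1 + (enorm x + 2 * B2 * t) * t * 2).
have W0 : 0 < W.
  by rewrite mulr_gt0// ltr_pwDl// !mulr_ge0 ?addr_ge0 ?mulr_ge0 ?(ltW t0).
pose A := Num.min (1 / (2 * t)) (eta / W).
have A0 : 0 < A by rewrite lt_min !divr_gt0// mulr_gt0.
have At : A * t <= 1 / 2.
  have : A <= 1 / (2 * t) by rewrite ge_min lexx.
  by rewrite ler_pdivlMr ?mulr_gt0//; clear; lra.
have AW : A * W <= eta.
  have : A <= eta / W by rewrite ge_min lexx orbT.
  by rewrite ler_pdivlMr.
exists A, (eta / 4); split => //; [exact: le_trans A2p (ltW A0) | by rewrite divr_gt0|].
have At0 : 0 < A * t by rewrite mulr_gt0.
have : `|expR (A * t) - 1 - A * t| <= 2 * (A * t) ^+ 2.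
  by apply: expR_taylor; rewrite gtr0_norm.
move=> /ler_normlP[_ ex].
have ex1 : expR (A * t) - 1 <= 2 * (A * t).
  apply: (@le_trans _ _ (A * t + 2 * (A * t) ^+ 2)); first by move: ex; clear; lra.
  by rewrite expr2; move: At At0; clear; nra.
have BA : B2 / A * (expR (A * t) - 1) <= B2 * t + 2 * B2 * t * (A * t).
  apply: (@le_trans _ _ (B2 / A * (A * t + 2 * (A * t) ^+ 2))).
    rewrite ler_wpM2l ?divr_ge0 ?(ltW A0)//; move: ex; clear; lra.
  by rewrite le_eqVlt; apply/orP; left; apply/eqP; field; rewrite gt_eqF.
have Nx : enorm x * (expR (A * t) - 1) <= enorm x * (2 * (A * t)) by rewrite ler_wpM2l.
have BB : 0 <= B2 * t * (A * t) by rewrite !mulr_ge0 ?(ltW A0) ?(ltW t0).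
have ee : eta / 4 * expR (A * t) <= eta / 4 * 2.
  by rewrite ler_wpM2l ?divr_ge0 ?(ltW eta0)//; move: ex1 At; clear; lra.
move: AW; rewrite /W => AW.
move: BA Nx ee AW BB A0 eta0; clear; lra.
Qed.

(** * The gradient bound *)

(** Freezing s = t removes the time slope and leaves a Frechet subgradient of the time slice. *)
Lemma subdiff_x_le {R : realType} {n : nat} (T : R) (u : 'rV[R]_n -> R -> R)
    (x p : 'rV[R]_n) (t : R) : 0 < t < T -> subdiff_x T u x t p ->
  forall e, 0 < e -> exists2 d, 0 < d & forall y, enorm (y - x) < d ->
    u x t + vdot p (y - x) - e * enorm (y - x) <= u y t.
Proof.
move=> tT [tau [phi [Dx [Dt [phiC1 [[r r0 mn] [-> _]]]]]]] e e0.
have [_ /(_ e e0)[d d0 hd]] := phiC1 x t tT.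
exists (Num.min r d); first by rewrite lt_min r0.
move=> y; rewrite lt_min => /andP[yr yd].
have := hd y t tT yd; have := mn y t tT yr; rewrite subrr normr0 => /(_ r0) h1 /(_ d0).
rewrite mulr0 subr0 addr0 => /ler_normlP[h2 _]; move: h1 h2; clear; lra.
Qed.

(** [J] is the primitive of exp ((C1 + lam) s) vanishing at 0; kept abstract, it treats both cases
    of the theorem at once. Half of the slack [eps] is spent on the subgradient inequality at (x,
    t), the other half makes the contradiction strict. *)
Lemma exists_small_subgradient {R : realType} {n : nat} (T lam C1 beta A2 B2 L0 : R)
    (H0 : 'rV[R]_n -> R -> 'rV[R]_n -> R) u0 u (J : R -> R) (x p : 'rV[R]_n)
    (t del eps : R) :
  hamiltonian_hyp T C1 beta A2 B2 H0 ->
  (forall x y, `|u0 x - u0 y| <= L0 * enorm (x - y)) -> visc_sol T lam H0 u0 u ->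
  J 0 = 0 -> 0 <= J t ->
  (forall s, taylor2 (fun (_ : 'rV[R]_n) s => J s) 0 s 0 (expR ((C1 + lam) * s))) ->
  0 < t < T -> subdiff_x T u x t p -> 0 < del -> 0 < eps ->
  exists y, exists q, [/\ enorm (y - x) <= Rad A2 B2 x t + del, subdiff u0 y q &
    enorm q < expR ((C1 + lam) * t) * (enorm p + eps) + C1 * beta * J t].
Proof.
move=> hH lipu0 visc J0 Jt0 JT tT px del0 eps0.
have [[C10 beta01] [A20 B20] contH lipx [lipp _]] := hH.
have [t0 tT2] := andP tT; have [b0 _] := andP beta01; have [uc [ui _]] := visc.
pose c := C1 + lam.
set th := expR _ * _ + _.
apply: contrapT => none.
have big y q : enorm (y - x) <= Rad A2 B2 x t + del -> subdiff u0 y q -> th <= enorm q.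
  by move=> yx yq; rewrite leNgt; apply/negP => lt; apply: none; exists y, q.
have th0 : 0 < th.
  rewrite ltr_pwDl ?mulr_ge0// mulr_gt0 ?expR_gt0//.
  by rewrite ltr_wpDl ?enorm_ge0.
have eps20 : 0 < eps / 2 by rewrite divr_gt0.
have del40 : 0 < del / 4 by rewrite divr_gt0.
have [d d0 hd] := subdiff_x_le tT px eps20.
(* The first bound keeps the ball at time [t] where the subgradient inequality at [x] holds; the
   second keeps the balls at time 0 where all subgradients are assumed large. *)
pose rho0 := Num.min (d / (2 * expR (C1 * t))) (del / 4).
have rho00 : 0 < rho0 by rewrite lt_min del40 divr_gt0// mulr_gt0// expR_gt0.
have rhod : rho0 * expR (C1 * t) < d.
  have : rho0 <= d / (2 * expR (C1 * t)) by rewrite ge_min lexx.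
  by rewrite ler_pdivlMr ?mulr_gt0 ?expR_gt0//; move: d0; clear; lra.
have rhodel : rho0 <= del / 4 by rewrite ge_min lexx orbT.
pose rho s := rho0 * expR (C1 * s).
(* Variation of constants for m' + lam m = - C1 beta rho: the factor exp (lam s) turns rho into rho0
   exp ((C1 + lam) s), whose primitive is rho0 J. *)
pose m s := expR (- lam * s) * (th * rho0 + - (C1 * beta * rho0) * J s).
have rhoP s : 0 < rho s by rewrite mulr_gt0// expR_gt0.
have rhoT s : taylor2 (fun (_ : 'rV[R]_n) s => rho s) 0 s 0 (C1 * rho s).
  have := taylor2Z rho0 (taylor2_expR C1 (0 : 'rV[R]_n) s).
  by rewrite scaler0 mulrCA.
have mT s : taylor2 (fun (_ : 'rV[R]_n) s => m s) 0 s 0 (- lam * m s - C1 * beta * rho s).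
  have := taylor2M (taylor2_expR (- lam) (0 : 'rV[R]_n) s)
    (taylor2D (taylor2_cst (th * rho0) 0 s) (taylor2Z (- (C1 * beta * rho0)) (JT s))).
  rewrite !scaler0 !addr0 scaler0 add0r.
  set v := _ + _ * (_ * _) => h; suff <- : v = - lam * m s - C1 * beta * rho s by exact: h.
  rewrite /v /m /rho; have -> : C1 * s = - lam * s + (C1 + lam) * s by ring.
  by rewrite expRD; ring.
pose w := ballinf u rho m.
have wc : cont_st0 T w.
  by apply: ballinf_cont => // s; [exact: taylor2_cont (rhoT s) | exact: taylor2_cont (mT s)].
have wsub := ballinf_subsol hH lipu0 visc rhoP rhoT mT.
have t0T : 0 <= (0 : R) < T by rewrite lexx (lt_trans t0).
have winit b : enorm (b - x) <= Rad A2 B2 x t + del / 2 -> w b 0 <= u0 b.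
  move=> bx; have [y q0 yb yq|y yb yle] := initial_decay (th := th) (rho := rho0) (x := b) lipu0 th0 rho00.
    by apply: big yq; have := enorm_tri b y x; move: bx yb rhodel del0; clear; lra.
  apply: le_trans yle; rewrite -ui.
  have rho0E : rho 0 = rho0 by rewrite /rho mulr0 expR0 mulr1.
  have := @ballinf_le _ _ T u rho m b y 0 uc t0T (rhoP 0).
  rewrite rho0E /m !mulr0 expR0 mul1r J0 mulr0 addr0; exact.
have [A [cth [A0 A2A cth0 radle]]] := Rad_approx x A20 B20 t0 del40.
set r0 := _ + _ * _ in radle.
pose t' := (t + T) / 2.
have tt' : t < t' by rewrite /t'; move: tT2; clear; lra.
have t'T : t' < T by rewrite /t'; move: tT2; clear; lra.
have [S1 S1P] := @cont_st0_bounded _ _ T w x (r0 + del / 4) t' wc t'T.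
have [S2 S2P] := @cont_st0_bounded _ _ T u x (r0 + del / 4) t' uc t'T.
pose S := `|S1| + `|S2|.
have wu : w x t <= u x t.
  rewrite leNgt; apply/negP => lt.
  pose K := `|lam| + 3 * C1 + 1.
  have D0 : 0 < w x t - u x t by rewrite subr_gt0.
  have S0 : 0 <= S by rewrite addr_ge0.
  have L1 : 0 < L0 ^+ 2 + 1 by rewrite ltr_wpDl ?sqr_ge0.
  (* The first term gives the localization 2 S < N (del / 4)^2; with the second, the error exp (K t)
     (L0^2 + 1) / N drops below the supposed gap w x t - u x t. *)
  pose N := (2 * S + 1) / (del / 4) ^+ 2 + expR (K * t) * (L0 ^+ 2 + 1) / (w x t - u x t).
  have N1 : 0 < (2 * S + 1) / (del / 4) ^+ 2.
    by rewrite divr_gt0 ?exprn_gt0// ltr_wpDl// mulr_ge0.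
  have N2 : 0 < expR (K * t) * (L0 ^+ 2 + 1) / (w x t - u x t).
    by rewrite divr_gt0// mulr_gt0// expR_gt0.
  have N0 : 0 < N by rewrite addr_gt0.
  have SN : 2 * S < N * (del / 4) ^+ 2.
    rewrite /N [ltRHS]mulrDl divfK ?gt_eqF ?exprn_gt0//.
    apply: (@lt_le_trans _ _ (2 * S + 1)); first by rewrite ltrDl.
    by rewrite lerDl mulr_ge0 ?(ltW N2) ?sqr_ge0.
  have gam01 : L0 ^+ 2 / 4 / N < (L0 ^+ 2 + 1) / N.
    rewrite ltr_pM2r ?invr_gt0//; have := sqr_ge0 L0; clear; lra.
  have Ngam : N^-1 <= (L0 ^+ 2 + 1) / N.
    by rewrite ler_peMl ?invr_ge0 ?(ltW N0)// lerDr sqr_ge0.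
  have bnd z s : enorm (z - x) <= r0 + del / 4 -> 0 <= s <= t' -> `|w z s| <= S /\ `|u z s| <= S.
    move=> zx st; split.
      by apply: le_trans (S1P z s zx st) _; rewrite (le_trans (ler_norm _))// lerDl.
    by apply: le_trans (S2P z s zx st) _; rewrite (le_trans (ler_norm _))// lerDr.
  have init a b : enorm (a - x) <= r0 -> enorm (b - x) <= r0 + del / 4 ->
      w b 0 - u a 0 <= N * vdot (b - a) (b - a) + L0 ^+ 2 / 4 / N.
    move=> _ bx; have wb : w b 0 <= u0 b.
      by apply: winit; move: bx radle; clear; lra.
    rewrite ui; have /ler_normlP[_ h] := lipu0 b a; rewrite -enorm_sqr.
    apply: (@le_trans _ _ (L0 * enorm (b - a))); first by move: h wb; clear; lra.
    rewrite -(ler_pM2l N0) mulrDr [N * (_ / N)]mulrCA divff ?gt_eqF// mulr1.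
    by have := sqr_ge0 (N * enorm (b - a) - L0 / 2); clear; lra.
  have xdel : enorm (x - x) <= del / 4 by rewrite subrr enorm0 ltW.
  have := comparison C10 beta01 A20 B20 contH lipx lipp wc uc wsub
    (fun x t p tau tT => visc_super visc tT) t0 tt' t'T A0 A2A cth0 del40 N0 gam01 Ngam
    bnd SN init xdel.
  rewrite subrr vdot0r mulr0 add0r -/K mulrA ler_pdivlMr// mulrDr [X in _ + X <= _]mulrC.
  rewrite divfK ?gt_eqF// leNgt => /negP; apply.
  by rewrite ltrDr mulr_gt0.
have tT' : 0 <= t < T by rewrite ltW.
have [e [e1 wE _]] := ballinfP rho m x uc tT'.
have rt := rhoP t.
have ed : enorm (rho t *: e) <= rho t by rewrite enormZ gtr0_norm// ler_piMr// ltW.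
have := hd (x + rho t *: e); rewrite (addrC x) addrK => /(_ (le_lt_trans ed rhod)).
rewrite (addrC _ x) => he.
have /ler_normlP[pe _] := vdot_abs p (rho t *: e).
have pb : enorm p * enorm (rho t *: e) <= enorm p * rho t by rewrite ler_wpM2l ?enorm_ge0.
have eb : eps / 2 * enorm (rho t *: e) <= eps / 2 * rho t by rewrite ler_wpM2l// ltW.
have mle : m t <= rho t * (enorm p + eps / 2).
  by move: wE wu; rewrite -/w; move: he pe pb eb; clear; lra.
have : expR (- lam * t) * rho0 * (th - C1 * beta * J t)
    <= expR (- lam * t) * rho0 * (expR ((C1 + lam) * t) * (enorm p + eps / 2)).
  have -> : expR (- lam * t) * rho0 * (th - C1 * beta * J t) = m t by rewrite /m; ring.
  apply: le_trans mle _; rewrite /rho (_ : C1 * t = - lam * t + (C1 + lam) * t); last by ring.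
  by rewrite expRD le_eqVlt; apply/orP; left; apply/eqP; ring.
rewrite ler_pM2l; last by rewrite mulr_gt0// expR_gt0.
rewrite /th addrK ler_pM2l ?expR_gt0//.
by move: eps0; clear; lra.
Qed.

(** The infima grow as [d] decreases to 0, so the limit exists, and it is enough to bound each of
    them by [K]. *)
Lemma Ilow_le {R : realType} {n : nat} (A2 B2 : R) (u0 : 'rV[R]_n -> R) (x : 'rV[R]_n) (t K : R) :
  (forall del eps : R, 0 < del -> 0 < eps -> exists y, exists q,
    [/\ enorm (y - x) <= Rad A2 B2 x t + del, subdiff u0 y q & enorm q <= K + eps]) ->
  (Ilow A2 B2 u0 x t <= K%:E)%E.
Proof.
move=> small; apply: lime_le.
  apply: nonincreasing_at_right_is_cvge; near=> a => d d' _ _ dd'.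
  apply: le_ereal_inf => _ [q [y [yx yq]] <-]; exists q => //; exists y; split => //.
  by apply: le_trans yx _; rewrite lerD2l.
near=> d; apply/lee_addgt0Pr => eps eps0.
have d0 : 0 < d by near: d; exact: nbhs_right_gt.
have [y [q [yx yq qK]]] := small d eps d0 eps0.
apply: (@le_trans _ _ (enorm q)%:E); last by rewrite -EFinD lee_fin.
by apply: ereal_inf_lbound; exists q => //; exists y.
Unshelve. all: by end_near. Qed.

Lemma subgradient_bound_approx {R : realType} {n : nat} (T lam C1 beta A2 B2 L0 : R)
    (H0 : 'rV[R]_n -> R -> 'rV[R]_n -> R) u0 u (J : R -> R) (x p : 'rV[R]_n) (t : R) :
  hamiltonian_hyp T C1 beta A2 B2 H0 ->
  (forall x y, `|u0 x - u0 y| <= L0 * enorm (x - y)) -> visc_sol T lam H0 u0 u ->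
  J 0 = 0 -> 0 <= J t ->
  (forall s, taylor2 (fun (_ : 'rV[R]_n) s => J s) 0 s 0 (expR ((C1 + lam) * s))) ->
  0 < t < T -> subdiff_x T u x t p ->
  (Ilow A2 B2 u0 x t <= (expR ((C1 + lam) * t) * enorm p + C1 * beta * J t)%:E)%E.
Proof.
move=> hH lipu0 visc J0 Jt JT tT px; apply: Ilow_le => del eps del0 eps0.
have e0 := expR_gt0 ((C1 + lam) * t).
have [y [q [yx yq qK]]] := exists_small_subgradient hH lipu0 visc J0 Jt JT tT px del0
  (divr_gt0 eps0 e0).
exists y, q; split=> //; apply: (le_trans (ltW qK)).
by rewrite mulrDr [X in _ + X + _]mulrC divfK ?gt_eqF// addrAC.
Qed.

Theorem theorem6p2 (R : realType) (n : nat) (T lam C1 beta A2 B2 : R)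
    (H0 : 'rV[R]_n -> R -> 'rV[R]_n -> R)
    (u0 : 'rV[R]_n -> R) (u : 'rV[R]_n -> R -> R) :
  0 < T ->
  (exists L : R, forall x y, `|u0 x - u0 y| <= L * enorm (x - y)) ->
  0 <= C1 -> (beta = 0 \/ beta = 1) -> 0 <= A2 -> 0 <= B2 ->
  cont_H T H0 ->
  (forall x y t p, 0 <= t <= T ->
     `|H0 x t p - H0 y t p| <= C1 * (beta + enorm p) * enorm (x - y)) ->
  (forall x t p q, 0 <= t <= T ->
     `|H0 x t p - H0 x t q| <= (A2 * enorm x + B2) * enorm (p - q)) ->
  (forall x t p q (th : R), 0 <= t <= T -> 0 <= th <= 1 ->
     H0 x t (th *: p + (1 - th) *: q)
       <= th * H0 x t p + (1 - th) * H0 x t q) ->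
  visc_sol T lam H0 u0 u ->
  forall x t, 0 < t < T -> forall p, subdiff_x T u x t p ->
    (lam != - C1 ->
       ((enorm p)%:E >=
          Ilow A2 B2 u0 x t * (expR (- (C1 + lam) * t))%:E
          - (C1 * beta / (C1 + lam) * (1 - expR (- (C1 + lam) * t)))%:E)%E) /\
    (lam = - C1 ->
       ((enorm p)%:E >= Ilow A2 B2 u0 x t - (C1 * beta * t)%:E)%E).
Proof.
move=> T0 [L lipu0] C10 beta01 A20 B20 contH lipx lipp conv visc x t tT p px.
have hH : hamiltonian_hyp T C1 beta A2 B2 H0.
  by split => //; split => //; case: beta01 => ->; rewrite ?lexx ?ler01.
have [t0 _] := andP tT; split=> lamC.
  pose c := C1 + lam.
  have c0 : c != 0 by rewrite /c addrC addr_eq0.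
  pose J s := c^-1 * (expR (c * s) + -1).
  have JT s : taylor2 (fun (_ : 'rV[R]_n) s => J s) 0 s 0 (expR (c * s)).
    have := taylor2Z c^-1 (taylor2D (taylor2_expR c (0 : 'rV[R]_n) s) (taylor2_cst (-1) 0 s)).
    by rewrite addr0 scaler0 addr0 mulrA mulVf// mul1r.
  have J0 : J 0 = 0 by rewrite /J mulr0 expR0 subrr mulr0.
  (* The factors c^-1 and exp (c t) - 1 have the same sign, whichever sign [c] has. *)
  have Jt : 0 <= J t.
    rewrite /J; have [cp|cn|ce] := ltgtP 0 c; last by rewrite -ce eqxx in c0.
      by rewrite mulr_ge0 ?invr_ge0 ?(ltW cp)// subr_ge0 -expR0 ler_expR mulr_ge0 ?ltW.
    rewrite mulr_le0// ?invr_le0 ?(ltW cn)// subr_le0 -expR0 ler_expR.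
    by rewrite nmulr_rle0// ltW.
  have Ile := subgradient_bound_approx hH lipu0 visc J0 Jt JT tT px.
  rewrite -/c; set a := expR (- c * t).
  (* Multiplication by [a], the inverse of exp (c t), isolates |p|, and the beta terms then cancel
     exactly. *)
  apply: (@le_trans _ _ ((expR (c * t) * enorm p + C1 * beta * J t)%:E * a%:E
    - (C1 * beta / c * (1 - a))%:E)%E).
    by rewrite leeD2r// lee_wpmul2r// lee_fin expR_ge0.
  rewrite -EFinM -EFinB lee_fin le_eqVlt; apply/orP; left; apply/eqP.
  have ea : expR (c * t) * a = 1 by rewrite /a -expRD mulNr addrN expR0.
  have -> : (expR (c * t) * enorm p + C1 * beta * J t) * a = (expR (c * t) * a) * enorm p
    + C1 * beta * (c^-1 * (expR (c * t) * a - a)) by rewrite /J; ring.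
  by rewrite ea; ring.
have c0 : C1 + lam = 0 by rewrite lamC addrN.
(* When C1 + lam = 0 the exponential is constantly 1 and its primitive is the identity. *)
have JT s : taylor2 (fun (_ : 'rV[R]_n) s => s) 0 s 0 (expR ((C1 + lam) * s)).
  exists 0, 1 => // y r _ _; rewrite c0 mul0r expR0 mul1r vdot0l subr0 subrr normr0 mul0r.
  exact: lexx.
have := subgradient_bound_approx hH lipu0 visc (erefl : (0 : R) = 0) (ltW t0) JT tT px.
rewrite c0 mul0r expR0 mul1r => Ile.
apply: (@le_trans _ _ ((enorm p + C1 * beta * t)%:E - (C1 * beta * t)%:E)%E).
  by rewrite leeD2r.
by rewrite -EFinB lee_fin addrK.
Qed.
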